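(* Let $(G,\rho,\omega)$ be a reversible random network, where $\omega:E(G)\to\mathbb R_+$ is a random edge weight carried as a mark, with $\mathbb E[1/c^G_\rho]<\infty$ and such that almost surely \[ \lim_{R\to\infty}\frac{\log\log \mathrm{vol}^G(\rho,R)}{\log R}=0. \] Suppose moreover that $\mathbb E[\omega(X_0,X_1)^2]<\infty$, where $\{X_n\}$ is the random walk on $G$ started from $X_0=\rho$. Then for every $\delta>0$, almost surely, for all sufficiently large $n$, \[ \mathbb E\Big[\max_{0\le t\le n}\mathrm{dist}^G_\omega(X_0,X_t)^2\ \Big|\ (G,\rho,\omega)\Big]\le n^{1+\delta}. \]
   Context: A random rooted network $(G,\rho,c^G,\xi)$ consists of a random locally finite connected graph $G$ (self-loops allowed), a root $\rho$, edge conductances $c^G:E(G)\to[0,\infty)$ and a marking $\xi$ (here $\xi=\omega$). Write $c^G_u=\sum_{v:\{u,v\}\in E(G)}c^G(\{u,v\})$. The random walk $\{X_n\}$ has $X_0=\rho$ and $\Pr[X_{n+1}=v\mid X_n=u]=c^G(\{u,v\})/c^G_u$. The network is reversible if a.s. $c^G_\rho>0$ and $(G,X_0,X_1,c^G,\xi)$ and $(G,X_1,X_0,c^G,\xi)$ have the same law. $B^G(x,R)$ is the ball in the graph distance, $\mathrm{vol}^G(x,R)=\sum_{y\in B^G(x,R)}c^G_y$. $\omega(X_0,X_1)$ denotes $\omega(\{X_0,X_1\})$. $\mathrm{dist}^G_\omega$ is the $\omega$-weighted path (pseudo)metric: the infimum over paths in $G$ between two vertices of the sum of $\omega$ over the path's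 edges. *)

(* Defs.v *)
From HB Require Import structures.
From mathcomp Require Import all_boot all_order all_algebra.
From mathcomp Require Import all_classical all_reals all_analysis measurable_realfun.
Set Implicit Arguments.
Unset Strict Implicit.
Unset Printing Implicit Defensive.
Import Order.TTheory GRing.Theory Num.Def Num.Theory.
Import numFieldNormedType.Exports.
Local Open Scope classical_set_scope.
Local Open Scope ring_scope.

(* A (labelled) network: vertices are labelled by natural numbers; the graph
   G is the connected component of the root for the symmetric adjacency
   relation [adj] (self-loops allowed); [cond] are the conductances c^G and
   [wt] is the mark omega (edge weight).  Values of [cond]/[wt] on non-edges
   and of everything outside the root's component are irrelevant. *)
Record network (R : realType) := Network {
  adj : nat -> nat -> bool;
  cond : nat -> nat -> R;
  wt : nat -> nat -> R }.

Section Net.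
Variable R : realType.
Implicit Types (N : network R).

Definition nbrs N (u : nat) : set nat := [set v | adj N u v].

Definition cdeg N (u : nat) : R := \sum_(v \in nbrs N u) cond N u v.

Definition step N (u v : nat) : R :=
  if adj N u v then cond N u v / cdeg N u else 0.

Definition comp N (x : nat) : set nat :=
  [set y | exists s : seq nat, path (adj N) x s /\ last x s = y].

Definition gball N (x : nat) (r : nat) : set nat :=
  [set y | exists s : seq nat, [/\ path (adj N) x s, last x s = y & (size s <= r)%N]].

Definition vol N (x : nat) (r : nat) : R := \sum_(y \in gball N x r) cdeg N y.

Fixpoint pathwt N (x : nat) (s : seq nat) : R :=
  if s is y :: s' then wt N x y + pathwt N y s' else 0.

Definition wdist N (x y : nat) : R :=
  inf [set d | exists s : seq nat, [/\ path (adj N) x s, last x s = y & d = pathwt N x s]].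

(* Quenched expectation E_x[F(X_0,...,X_n)] for the random walk on N
   started at x, F a functional of the trajectory [:: X_0; ...; X_n]. *)
Fixpoint walkE N (n : nat) (x : nat) (F : seq nat -> R) : R :=
  if n is n'.+1 then
    \sum_(y \in nbrs N x) step N x y * walkE N n' y (fun s => F (x :: s))
  else F [:: x].

Definition wf_network N (rho : nat) : Prop :=
  forall u, comp N rho u ->
    finite_set (nbrs N u) /\
    forall v, adj N u v ->
      [/\ adj N v u, cond N u v = cond N v u, 0 <= cond N u v,
          wt N u v = wt N v u & 0 <= wt N u v].

Definition rooted_iso N (x : nat) N' (x' : nat) (phi : nat -> nat) : Prop :=
  [/\ phi x = x',
      {in comp N x &, injective phi},
      phi @` comp N x = comp N' x' &
      forall u v, comp N x u -> comp N x v ->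
        adj N' (phi u) (phi v) = adj N u v /\
        (adj N u v -> cond N' (phi u) (phi v) = cond N u v /\
                      wt N' (phi u) (phi v) = wt N u v)].

(* functionals of doubly-rooted networks which are invariant under
   isomorphism (i.e. functionals of isomorphism classes) *)
Definition iso_invariant (F : network R -> nat -> nat -> \bar R) : Prop :=
  forall N x y N' x' phi, rooted_iso N x N' x' phi -> comp N x y ->
    F N x y = F N' (phi x) (phi y).

Definition coord_sets : set (set (network R)) :=
  [set A | exists u v : nat,
      (exists b : bool, A = [set N | adj N u v = b]) \/
      (exists B : set R, measurable B /\
         (A = (fun N => cond N u v) @^-1` B \/ A = (fun N => wt N u v) @^-1` B))].

Definition net_measurable (f : network R -> \bar R) : Prop :=
  forall B : set (\bar R), measurable B -> <<s coord_sets >> (f @^-1` B).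

Definition random_network (d : measure_display) (Omega : measurableType d)
  (net : Omega -> network R) (rt : Omega -> nat) : Prop :=
  [/\ forall k, measurable (rt @^-1` [set k]),
      forall u v (b : bool), measurable [set w | adj (net w) u v = b],
      forall u v (B : set R), measurable B ->
        measurable ((fun w => cond (net w) u v) @^-1` B),
      forall u v (B : set R), measurable B ->
        measurable ((fun w => wt (net w) u v) @^-1` B) &
      forall w, wf_network (net w) (rt w)].

(* Reversibility: a.s. c_rho > 0 and (G,X0,X1,c,omega) has the same law as
   (G,X1,X0,c,omega), i.e. E[F(G,X0,X1)] = E[F(G,X1,X0)] for every
   nonnegative measurable isomorphism-invariant functional F. *)
Definition reversible (d : measure_display) (Omega : measurableType d)
  (P : probability Omega R) (net : Omega -> network R) (rt : Omega -> nat) : Prop :=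
  {ae P, forall w, 0 < cdeg (net w) (rt w)} /\
  forall F : network R -> nat -> nat -> \bar R,
    (forall N x y, (0 <= F N x y)%E) ->
    (forall x y, net_measurable (fun N => F N x y)) ->
    iso_invariant F ->
    (\int[P]_w (\big[adde/0%E]_(y \in nbrs (net w) (rt w))
                  ((step (net w) (rt w) y)%:E * F (net w) (rt w) y)%E))%E =
    (\int[P]_w (\big[adde/0%E]_(y \in nbrs (net w) (rt w))
                  ((step (net w) (rt w) y)%:E * F (net w) y (rt w))%E))%E.

End Net.

(* Main.v *)
Require Import Defs.
From HB Require Import structures.
From mathcomp Require Import all_boot all_order all_algebra finmap.
From mathcomp Require Import all_classical all_reals all_analysis measurable_realfun.
From mathcomp Require Import ring lra.
Set Implicit Arguments.
Unset Strict Implicit.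
Unset Printing Implicit Defensive.
Import Order.TTheory GRing.Theory Num.Def Num.Theory.
Import numFieldNormedType.Exports.
Local Open Scope classical_set_scope.
Local Open Scope ring_scope.

(** Let [f] be the distance to the root, [b(x)] and [h(x)] the mean and the mean
square of the increment of [f] in one step from [x].  As [exp (u - u^2) <= 1 + u + u^2],
the exponential of the sum along the walk of
[th * df - th^2 * df^2 - th * b(x) - th^2 * h(x)] is a supermartingale for every [th];
by reversibility so is its analogue along the reversed path.  In the half-sum of
the two exponents the drifts telescope, which leaves [th * (f(X_t) - f(X_0))] minus
[th^2] times a quadratic variation [Q].  Hence [f(X_t)^2 <= L * Q] except on an event
whose contribution is [exp (- L / 32)] times a polynomial in the length of the path
times the energy of the ball.  To bound that contribution in mean square with no
moment beyond the second one, the exponential martingales are only started at the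
first, and the reversed ones at the last, step whose size is comparable to
[f(X_t) / n]: these steps pay for the dyadic scale of [f(X_t)].

The mass transport principle, derived from reversibility for the [s]-step walk,
bounds the mean energy [E h(X_s)] by stationarity, and the energy of the part of the
ball reached in [s] steps by a polynomial in [s] times its volume.  The volume being
subexponential, [L] of order [n^e] suffices. *)

Local Notation comp := Defs.comp.

(** * Real inequalities and sequences *)

Lemma expR_sub_sqr_le (R : realType) (u : R) : expR (u - u ^+ 2) <= 1 + u + u ^+ 2.
Proof.
have pos : 0 < 1 - u + u ^+ 2 by nra.
have expN : 1 - u + u ^+ 2 <= (expR (u - u ^+ 2))^-1.
  by rewrite -expRN; apply: le_trans (expR_ge1Dx _); lra.
rewrite -[leLHS]invrK (@le_trans _ _ (1 - u + u ^+ 2)^-1)//.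
  by rewrite lef_pV2 ?posrE ?invr_gt0 ?expR_gt0.
by rewrite -div1r ler_pdivrMr//; nra.
Qed.

Lemma expR_midpoint_le (R : realType) (x y : R) :
  2 * expR ((x + y) / 2) <= expR x + expR y.
Proof.
have sqr_half (z : R) : expR z = expR (z / 2) ^+ 2 by rewrite expr2 -expRD -splitr.
rewrite [(x + y) / 2]mulrDl expRD (sqr_half x) (sqr_half y).
by have := sqr_ge0 (expR (x / 2) - expR (y / 2)); nra.
Qed.

Section DyadicScales.
Context (R : realFieldType).
Implicit Types (a z : R) (j J : nat).

Lemma dyadic_scale_exists a J : 1 <= a -> a < 2 ^+ J ->
  exists2 j, (j < J)%N & 2 ^+ j <= a < 2 ^+ j.+1.
Proof.
move=> a1; elim: J => [|J IH] aJ; first by move: aJ; rewrite expr0 ltNge a1.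
have [Ja|/IH[j jJ ja]] := leP (2 ^+ J) a; first by exists J; rewrite ?Ja.
by exists j => //; exact: leqW.
Qed.

Lemma sum_dyadic_sqr_le z J : 0 <= z ->
  \sum_(j < J) (2 ^+ j) ^+ 2 * (2 ^+ j <= z)%R%:R <= 2 * z ^+ 2.
Proof.
move=> z0.
pose S K : R := \sum_(j < K) (2 ^+ j) ^+ 2 * (2 ^+ j <= z)%R%:R.
suff : S J <= 2 * z ^+ 2 /\ S J <= (2 ^+ J) ^+ 2 / 3 by case.
elim: J => [|J [IHz IHJ]]; first by rewrite /S big_ord0; split; nra.
have -> : S J.+1 = S J + (2 ^+ J) ^+ 2 * (2 ^+ J <= z)%R%:R by rewrite /S big_ord_recr.
have : 0 < 2 ^+ J :> R by rewrite exprn_gt0.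
rewrite [2 ^+ J.+1]exprS; move: IHJ; set x := 2 ^+ J => IHJ x0.
by case: (leP x z) => xz; rewrite ?mulr1 ?mulr0 ?addr0; split; nra.
Qed.

End DyadicScales.

Section StepsOfSequences.
Context (R : realFieldType).
Implicit Types (u : nat -> R) (e : R).

Lemma small_steps_le u e m k : (m <= k)%N ->
  (forall i, (m <= i < k)%N -> `|u i.+1 - u i| <= e) -> u k - u m <= (k - m)%:R * e.
Proof.
move=> mk ue; rewrite -(telescope_sumr u mk).
apply: (@le_trans _ _ (\sum_(m <= i < k) e)).
  by rewrite big_nat [leRHS]big_nat; apply: ler_sum => i /ue; apply: le_trans; exact: ler_norm.
by rewrite big_const_nat iter_addr addr0 mulr_natl.
Qed.

(* The steps before the first and after the last step of size at least [e] move [u] by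
   at most half of its displacement in total. *)
Lemma large_steps_window u n t : (t <= n)%N -> u 0%N < u t ->
  let e := (u t - u 0%N) / (2 * n%:R) in
  exists r r', [/\ (r <= r')%N, (r' < t)%N, e <= `|u r.+1 - u r|,
    e <= `|u r'.+1 - u r'| & (u t - u 0%N) / 2 <= u r'.+1 - u r].
Proof.
move=> tn u0t e.
have n0 : 0 < n%:R :> R.
  by rewrite ltr0n (leq_trans _ tn)// lt0n; apply: contraTneq u0t => ->; rewrite ltxx.
have ne : n%:R * e = (u t - u 0%N) / 2 by rewrite /e; field; rewrite lt0r_neq0.
have e0 : 0 <= e by rewrite divr_ge0 ?mulr_ge0 ?ltW// subr_gt0.
pose large i := (i < t)%N && (e <= `|u i.+1 - u i|).
have [i0 large_i0] : exists i, large i.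
  apply: contrapT => /forallNP small.
  have : u t - u 0%N <= (t - 0)%:R * e.
    apply: small_steps_le => // i /andP[_ it].
    by have /negP := small i; rewrite /large it/= -ltNge => /ltW.
  have : t%:R * e <= n%:R * e by rewrite ler_wpM2r ?ler_nat.
  by rewrite subn0; lra.
have large_lt i : large i -> (i <= t)%N by case/andP => /ltnW.
have [r /andP[rt re] rmin] := ex_minnP (ex_intro large i0 large_i0).
have [r' /andP[r't r'e] rmax] := ex_maxnP (ex_intro large i0 large_i0) large_lt.
exists r, r'; split => //; first by apply: rmin; rewrite /large r't.
have before : u r - u 0%N <= (r - 0)%:R * e.
  apply: small_steps_le => // i /andP[_ ir]; rewrite leNgt; apply/negP => /ltW ei.
  by have /rmin : large i; [rewrite /large ei (ltn_trans ir rt)|rewrite leqNgt ir].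
have after : u t - u r'.+1 <= (t - r'.+1)%:R * e.
  apply: small_steps_le => // i /andP[r'i it]; rewrite leNgt; apply/negP => /ltW ei.
  by have /rmax : large i; [rewrite /large ei it|rewrite leqNgt r'i].
have rr' : (r <= r'.+1)%N by apply/leqW/rmin; rewrite /large r't.
have : (r - 0)%:R * e + (t - r'.+1)%:R * e <= n%:R * e.
  rewrite -mulrDl -natrD ler_wpM2r// ler_nat subn0 (leq_trans _ tn)//.
  by rewrite -[leqRHS](subnKC r't) leq_add2r.
by lra.
Qed.

End StepsOfSequences.

(** * Kernels on a finite set *)

Section FiniteKernels.
Context (R : realFieldType) (V : finType).
Implicit Types (q : V -> V -> R) (v w u c : V -> R) (k : nat -> V -> V -> R).

Definition kact q v x : R := \sum_y q x y * v y.

Fixpoint kprod n k v : V -> R :=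
  if n is n'.+1 then kact (k 0%N) (kprod n' (fun i => k i.+1) v) else v.

Lemma le_kact q v w x : (forall y, 0 <= q x y) -> (forall y, v y <= w y) ->
  kact q v x <= kact q w x.
Proof. by move=> q0 vw; apply: ler_sum => y _; rewrite ler_wpM2l. Qed.

Lemma kact_le_row_sum q v x : (forall y, 0 <= q x y) -> (forall y, v y <= 1) ->
  kact q v x <= \sum_y q x y.
Proof. by move=> q0 v1; apply: ler_sum => y _; rewrite ler_piMr. Qed.

Lemma kact_ge0 q v x : (forall y, 0 <= q x y) -> (forall y, 0 <= v y) -> 0 <= kact q v x.
Proof. by move=> q0 v0; apply: sumr_ge0 => y _; rewrite mulr_ge0. Qed.

Lemma kactZ q a v x : kact q (fun y => a * v y) x = a * kact q v x.
Proof. by rewrite /kact mulr_sumr; apply: eq_bigr => y _; rewrite mulrCA. Qed.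

Lemma kact_sum q (I : Type) (l : seq I) (v : I -> V -> R) x :
  kact q (fun y => \sum_(i <- l) v i y) x = \sum_(i <- l) kact q (v i) x.
Proof. by rewrite exchange_big; apply: eq_bigr => y _; rewrite mulr_sumr. Qed.

Lemma eq_kact q v w x : v =1 w -> kact q v x = kact q w x.
Proof. by move=> vw; apply: eq_bigr => y _; rewrite vw. Qed.

Lemma le_kact_iter q v w n x : (forall x y, 0 <= q x y) -> (forall y, v y <= w y) ->
  iter n (kact q) v x <= iter n (kact q) w x.
Proof. by move=> q0 vw; elim: n x => //= n IH x; exact: le_kact. Qed.

Lemma kact_iter_ge0 q v n x : (forall x y, 0 <= q x y) -> (forall y, 0 <= v y) ->
  0 <= iter n (kact q) v x.
Proof. by move=> q0 v0; elim: n x => //= n IH x; exact: kact_ge0. Qed.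

Lemma kact_iterZ q a v n x :
  iter n (kact q) (fun y => a * v y) x = a * iter n (kact q) v x.
Proof. by elim: n x => //= n IH x; rewrite -kactZ; exact: eq_kact. Qed.

Lemma kact_iter_sum q (I : Type) (l : seq I) (v : I -> V -> R) n x :
  iter n (kact q) (fun y => \sum_(i <- l) v i y) x = \sum_(i <- l) iter n (kact q) (v i) x.
Proof. by elim: n x => //= n IH x; rewrite -kact_sum; exact: eq_kact. Qed.

Lemma kprod_iter n k q v x : (forall i x y, (i < n)%N -> k i x y = q x y) ->
  kprod n k v x = iter n (kact q) v x.
Proof.
elim: n k x => //= n IH k x kq; apply: eq_bigr => y _.
by rewrite kq// IH// => i z z' ilt; rewrite kq.
Qed.

Lemma kprod_le1 n k x : (forall i x y, 0 <= k i x y) ->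
  (forall i x, \sum_y k i x y <= 1) -> kprod n k (fun=> 1) x <= 1.
Proof.
elim: n k x => //= n IH k x k0 k1; apply: le_trans (k1 0%N x).
by apply: kact_le_row_sum => // y; exact: IH.
Qed.

Lemma kprod_le_prefix n r k x : (r < n)%N -> (forall i x y, 0 <= k i x y) ->
  (forall i x, (r < i)%N -> \sum_y k i x y <= 1) ->
  kprod n k (fun=> 1) x <= kprod r k (fun y => \sum_z k r y z) x.
Proof.
elim: r n k x => [|r IH] [|n] k x //= rn k0 k1.
  by apply: kact_le_row_sum => // y; apply: kprod_le1 => // i z; exact: k1.
by apply: le_kact => // y; apply: (IH n (fun i => k i.+1)) => // i z ri; exact: k1.
Qed.

Lemma kact_adjoint c q q' u v : (forall x y, c x * q x y = c y * q' y x) ->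
  \sum_x c x * (u x * kact q v x) = \sum_x c x * (v x * kact q' u x).
Proof.
move=> qq'; transitivity (\sum_x \sum_y c x * q x y * (u x * v y)).
  by apply: eq_bigr => x _; rewrite !mulr_sumr; apply: eq_bigr => y _; ring.
rewrite exchange_big; apply: eq_bigr => x _; rewrite !mulr_sumr.
by apply: eq_bigr => y _ /=; rewrite qq'; ring.
Qed.

(* Moving the first [r] kernels to the other side of the pairing with [c] replaces them
   by their adjoints, so that only the sums of the rows of the [r]-th adjoint remain. *)
Lemma kprod_le_adjoint n r c k k' u : (r < n)%N -> (forall x, 0 <= c x) ->
  (forall i x y, 0 <= k i x y) -> (forall i x y, 0 <= k' i x y) ->
  (forall i x y, c x * k i x y = c y * k' i y x) ->
  (forall i x, (i < r)%N -> \sum_y k' i x y <= 1) ->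
  (forall i x, (r < i)%N -> \sum_y k i x y <= 1) ->
  (forall x, 0 <= u x <= 1) ->
  \sum_x c x * (u x * kprod n k (fun=> 1) x) <= \sum_x c x * \sum_y k' r x y.
Proof.
elim: r n k k' u => [|r IH] [|n] k k' u //= rn c0 k0 k'0 kk' k'1 k1 u01.
  rewrite (kact_adjoint _ _ (kk' 0%N)); apply: ler_sum => x _; rewrite ler_wpM2l//.
  apply: (@le_trans _ _ (kact (k' 0%N) u x)); last first.
    by apply: kact_le_row_sum => // y; case/andP: (u01 y).
  rewrite ler_piMl ?kprod_le1//; last by move=> i y; exact: k1.
  by apply: kact_ge0 => // y; case/andP: (u01 y).
rewrite (kact_adjoint _ _ (kk' 0%N)).
under [leLHS]eq_bigr do rewrite [X in _ * X]mulrC.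
apply: (IH n (fun i => k i.+1) (fun i => k' i.+1)) => // [i x ir|i x ir|x].
- exact: k'1.
- exact: k1.
- rewrite kact_ge0//=; last by move=> y; case/andP: (u01 y).
  apply: le_trans (k'1 0%N x _) => //.
  by apply: kact_le_row_sum => // y; case/andP: (u01 y).
Qed.

End FiniteKernels.

(** * Path expectations of a killed Markov chain *)

Section PathExpectation.
Context (R : realType) (V : finType) (p : V -> V -> R).
Implicit Types (F G : seq V -> R) (g : V -> V -> R) (T : nat -> V -> V -> R).

Fixpoint pathE n x F : R :=
  if n is n'.+1 then \sum_y p x y * pathE n' y (fun s => F (x :: s)) else F [:: x].

Lemma eq_pathE n x F G : (forall t, size t = n -> F (x :: t) = G (x :: t)) ->
  pathE n x F = pathE n x G.
Proof.
elim: n x F G => [|n IH] x F G FG /=; first exact: FG.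
by apply: eq_bigr => y _; congr (_ * _); apply: IH => t tn; apply: FG; rewrite /= tn.
Qed.

Lemma pathED n x F G : pathE n x (fun s => F s + G s) = pathE n x F + pathE n x G.
Proof.
elim: n x F G => //= n IH x F G.
by rewrite -big_split; apply: eq_bigr => y _; rewrite IH mulrDr.
Qed.

Lemma pathEZ n x a F : pathE n x (fun s => a * F s) = a * pathE n x F.
Proof.
elim: n x F => //= n IH x F.
by rewrite mulr_sumr; apply: eq_bigr => y _; rewrite IH mulrCA.
Qed.

Lemma pathE_sum n x (I : Type) (l : seq I) (F : I -> seq V -> R) :
  pathE n x (fun s => \sum_(i <- l) F i s) = \sum_(i <- l) pathE n x (F i).
Proof.
elim: l => [|i l IH].
  rewrite big_nil -[RHS](mul0r (pathE n x (fun=> 1))) -pathEZ.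
  by apply: eq_pathE => t _; rewrite big_nil mul0r.
by rewrite big_cons -IH -pathED; apply: eq_pathE => t _; rewrite big_cons.
Qed.

Lemma pathE_prod x0 n x (k : nat -> V -> V -> R) :
  pathE n x (fun s => \prod_(i < n) k i (nth x0 s i) (nth x0 s i.+1)) =
  kprod n (fun i x y => p x y * k i x y) (fun=> 1) x.
Proof.
elim: n x k => [|n IH] x k /=; first by rewrite big_ord0.
apply: eq_bigr => y _; rewrite -mulrA; congr (_ * _).
by rewrite -IH -pathEZ; apply: eq_pathE => t _; rewrite big_ord_recl.
Qed.

Hypothesis p_ge0 : forall x y, 0 <= p x y.
Hypothesis p_le1 : forall x, \sum_y p x y <= 1.

Lemma le_pathE n x F G : (forall t, size t = n -> F (x :: t) <= G (x :: t)) ->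
  pathE n x F <= pathE n x G.
Proof.
elim: n x F G => [|n IH] x F G FG /=; first exact: FG.
by apply: ler_sum => y _; rewrite ler_wpM2l// IH// => t tn; apply: FG; rewrite /= tn.
Qed.

Lemma pathE_cst_le n x a : 0 <= a -> pathE n x (fun=> a) <= a.
Proof.
move=> a0; elim: n x => //= n IH x.
apply: (@le_trans _ _ (\sum_y p x y * a)); first exact: le_kact.
by rewrite -mulr_suml ler_piMl.
Qed.

Let marked r g T i x y : R := (if i == r then g x y else 1) * expR (T i x y).

Let marked_ge0 r g T i x y : (forall x y, 0 <= g x y) -> 0 <= p x y * marked r g T i x y.
Proof. by move=> g0; rewrite !mulr_ge0 ?expR_ge0//; case: ifP. Qed.

Let pathE_marked x0 n r g T x : (r < n)%N ->
  pathE n x (fun s => g (nth x0 s r) (nth x0 s r.+1) *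
    expR (\sum_(i < n) T i (nth x0 s i) (nth x0 s i.+1))) =
  kprod n (fun i x y => p x y * marked r g T i x y) (fun=> 1) x.
Proof.
move=> rn; rewrite -(pathE_prod x0); apply: eq_pathE => t _.
rewrite big_split/= -expR_sum; congr (_ * _).
by rewrite (bigD1 (Ordinal rn))//= eqxx big1 ?mulr1// => i ir; rewrite ifN.
Qed.

Lemma pathE_tilted_after x0 n r g T (b : R) x : (r < n)%N -> (forall x y, 0 <= g x y) ->
  (forall i x y, (i < r)%N -> T i x y = 0) -> (forall x y, T r x y <= b) ->
  (forall i x, (r < i)%N -> \sum_y p x y * expR (T i x y) <= 1) ->
  pathE n x (fun s => g (nth x0 s r) (nth x0 s r.+1) *
    expR (\sum_(i < n) T i (nth x0 s i) (nth x0 s i.+1))) <=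
  expR b * iter r (kact p) (fun y => \sum_z p y z * g y z) x.
Proof.
move=> rn g0 T0 Tb T1.
rewrite pathE_marked// -kact_iterZ.
apply: le_trans (@kprod_le_prefix _ _ n r _ x rn _ _) _ => [i y z|i y ri|].
- exact: marked_ge0.
- by under eq_bigr do rewrite /marked gtn_eqF// mul1r; exact: T1.
rewrite (kprod_iter (q := p)) => [|i y z ir]; last first.
  by rewrite /marked ltn_eqF// T0// expR0 !mulr1.
apply: le_kact_iter => // y; rewrite mulr_sumr; apply: ler_sum => z _.
by rewrite /marked eqxx [leRHS]mulrCA ler_wpM2l// mulrC ler_wpM2r// ler_expR.
Qed.

Lemma pathE_tilted_before (c : V -> R) n r g T (b : R) x : (r < n)%N ->
  (forall x, 0 <= c x) -> (forall x y, c x * p x y = c y * p y x) ->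
  (forall x y, 0 <= g x y) ->
  (forall i x y, (r < i)%N -> T i x y = 0) -> (forall x y, T r x y <= b) ->
  (forall i x, (i < r)%N -> \sum_y p x y * expR (T i y x) <= 1) ->
  c x * pathE n x (fun s => g (nth x s r) (nth x s r.+1) *
    expR (\sum_(i < n) T i (nth x s i) (nth x s i.+1))) <=
  expR b * \sum_y c y * \sum_z p y z * g z y.
Proof.
move=> rn c0 prev g0 T0 Tb T1.
rewrite pathE_marked//; set k := fun i y z => p y z * marked r g T i y z.
have -> : c x * kprod n k (fun=> 1) x =
    \sum_y c y * ((y == x)%:R * kprod n k (fun=> 1) y).
  rewrite (bigD1 x)//= eqxx mul1r big1 ?addr0// => y /negbTE ->.
  by rewrite mul0r mulr0.
apply: le_trans (@kprod_le_adjoint _ _ n r c k (fun i y z => p y z * marked r g T i z y)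
    _ rn c0 _ _ _ _ _ _) _ => [i y z|i y z|i y z|i y ir|i y ri|y|].
- exact: marked_ge0.
- by rewrite !mulr_ge0 ?expR_ge0//; case: ifP.
- by rewrite /k !mulrA prev.
- by under eq_bigr do rewrite /marked ltn_eqF// mul1r; exact: T1.
- by under eq_bigr do rewrite /k /marked gtn_eqF// mul1r T0// expR0 mulr1.
- by case: (y == x); rewrite lexx ler01.
rewrite mulr_sumr; apply: ler_sum => y _; rewrite mulrCA ler_wpM2l// mulr_sumr.
apply: ler_sum => z _.
by rewrite /marked eqxx [leRHS]mulrCA ler_wpM2l// mulrC ler_wpM2r// ler_expR.
Qed.

Lemma pathE_step_le x0 n r g x : (r < n)%N -> (forall x y, 0 <= g x y) ->
  pathE n x (fun s => g (nth x0 s r) (nth x0 s r.+1)) <=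
  iter r (kact p) (fun y => \sum_z p y z * g y z) x.
Proof.
move=> rn g0; rewrite -[leRHS]mul1r -expR0.
apply: le_trans (pathE_tilted_after x0 x (T := fun _ _ _ => 0) rn g0 _ _ _) => //.
  by rewrite le_eqVlt; apply/predU1P; left; apply: eq_pathE => t _; rewrite big1// expR0 mulr1.
by move=> i y _; under eq_bigr do rewrite expR0 mulr1.
Qed.

End PathExpectation.

(** * Displacement of a reversible chain *)

Lemma sum_ord_window (M : nmodType) n r r' (F : nat -> M) : (r' <= n)%N ->
  \sum_(i < n) (if (r <= i < r')%N then F i else 0) = \sum_(r <= i < r') F i.
Proof.
move=> r'n; rewrite -big_mkcond/= (big_nat_widenl r 0)// (big_nat_widen 0 r' n)// big_mkord.
by apply: eq_bigl => i; rewrite andbC.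
Qed.

Section Tilts.
Context (R : realType) (V : finType) (p : V -> V -> R) (f : V -> R).
Hypothesis p_ge0 : forall x y, 0 <= p x y.
Hypothesis p_le1 : forall x, \sum_y p x y <= 1.

Definition incr x y : R := f y - f x.
Definition drift x : R := \sum_y p x y * incr x y.
Definition energy x : R := \sum_y p x y * incr x y ^+ 2.

Definition tilt th x y : R :=
  th * incr x y - th ^+ 2 * incr x y ^+ 2 - th * drift x - th ^+ 2 * energy x.

Lemma energy_ge0 x : 0 <= energy x.
Proof. by apply: sumr_ge0 => y _; rewrite mulr_ge0// sqr_ge0. Qed.

Lemma drift_energy_ge th x : - (1 / 4) <= th * drift x + th ^+ 2 * energy x.
Proof.
rewrite /drift /energy !mulr_sumr -big_split/=.
apply: (@le_trans _ _ (\sum_y p x y * - (1 / 4))).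
  by rewrite -mulr_suml; have := p_le1 x; nra.
apply: ler_sum => y _; set d := incr x y.
rewrite mulrCA [_ ^+ 2 * _]mulrCA -mulrDr -exprMn ler_wpM2l//.
by have := sqr_ge0 (th * d + 1 / 2); nra.
Qed.

Lemma tilt_le_half th x y : tilt th x y <= 1 / 2.
Proof.
have := drift_energy_ge th x; rewrite /tilt.
by have := sqr_ge0 (th * incr x y - 1 / 2); nra.
Qed.

Lemma sum_expR_tilt_le1 th x : \sum_y p x y * expR (tilt th x y) <= 1.
Proof.
pose b := th * drift x + th ^+ 2 * energy x.
apply: (@le_trans _ _ ((\sum_y p x y + b) * expR (- b))); last first.
  rewrite expRN ler_pdivrMr ?expR_gt0// mul1r; apply: le_trans (expR_ge1Dx b).
  by rewrite lerD2r.
have -> : \sum_y p x y + b =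
    \sum_y p x y * (1 + th * incr x y + (th * incr x y) ^+ 2).
  rewrite /b /drift /energy !mulr_sumr -!big_split/=.
  by apply: eq_bigr => y _; ring.
rewrite mulr_suml; apply: ler_sum => y _; rewrite -mulrA ler_wpM2l//.
have -> : tilt th x y = th * incr x y - (th * incr x y) ^+ 2 + - b.
  by rewrite /tilt /b; ring.
by rewrite expRD ler_wpM2r ?expR_ge0// expR_sub_sqr_le.
Qed.

Definition qvar_step x y : R := incr x y ^+ 2 + energy x + energy y.

Lemma qvar_step_ge0 x y : 0 <= qvar_step x y.
Proof. by rewrite !addr_ge0 ?sqr_ge0 ?energy_ge0. Qed.

(* The drifts of the walk and of the reversed walk telescope in the sum of the exponents. *)
Lemma tilt_path_ge (X : nat -> V) th r r' : (r <= r')%N ->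
  th * (f (X r'.+1) - f (X r)) -
    th ^+ 2 * (\sum_(r <= i < r'.+1) qvar_step (X i) (X i.+1)) - 1 / 4 <=
  (\sum_(r <= i < r'.+1) tilt th (X i) (X i.+1) +
   \sum_(r <= i < r'.+1) tilt (- th) (X i.+1) (X i)) / 2.
Proof.
move=> rr'.
set A := \sum_(r <= i < r'.+1) incr (X i) (X i.+1) ^+ 2.
set B := \sum_(r <= i < r'.+1) energy (X i).
set C := \sum_(r <= i < r'.+1) energy (X i.+1).
have -> : \sum_(r <= i < r'.+1) qvar_step (X i) (X i.+1) = A + B + C.
  by rewrite /A /B /C -!big_split.
have -> : \sum_(r <= i < r'.+1) tilt th (X i) (X i.+1) +
   \sum_(r <= i < r'.+1) tilt (- th) (X i.+1) (X i) =
   2 * th * (f (X r'.+1) - f (X r)) - 2 * th ^+ 2 * A - th ^+ 2 * B - th ^+ 2 * C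
   + th * (drift (X r'.+1) - drift (X r)).
  rewrite -(telescope_sumr (fun i => f (X i)) (leqW rr')).
  rewrite -(telescope_sumr (fun i => drift (X i)) (leqW rr')).
  rewrite /A /B /C !mulr_sumr -!sumrN -!big_split/=; apply: eq_bigr => i _.
  by rewrite /tilt /incr; ring.
have first_energy_le : energy (X r) <= B.
  by rewrite /B big_ltn// lerDl sumr_ge0// => i _; exact: energy_ge0.
have last_energy_le : energy (X r'.+1) <= C.
  by rewrite /C big_nat_recr//= lerDr sumr_ge0// => i _; exact: energy_ge0.
have := drift_energy_ge th (X r'.+1); have := drift_energy_ge (- th) (X r).
have := sqr_ge0 th; nra.
Qed.

End Tilts.

Lemma tilt_exponent_ge (R : realFieldType) (L scale a D Q : R) :
  0 < L -> 0 < scale -> scale <= a <= 2 * scale -> a / 2 <= D -> L * Q <= a ^+ 2 ->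
  L / 32 <= L / 8 / scale * D - (L / 8 / scale) ^+ 2 * Q.
Proof.
move=> L0 scale0 /andP[scale_a a_scale] aD Qa.
pose z := a / scale.
have z1 : 1 <= z by rewrite ler_pdivlMr// mul1r.
have z2 : z <= 2 by rewrite ler_pdivrMr.
have first_order : L / 16 * z <= L / 8 / scale * D.
  have -> : L / 16 * z = L / 8 / scale * (a / 2) by rewrite /z; field; rewrite gt_eqF.
  by rewrite ler_wpM2l// !divr_ge0// ltW.
have second_order : (L / 8 / scale) ^+ 2 * Q <= L / 64 * z ^+ 2.
  have -> : L / 64 * z ^+ 2 = (L / 8 / scale) ^+ 2 * (a ^+ 2 / L).
    by rewrite /z; field; rewrite !gt_eqF.
  by rewrite ler_wpM2l ?sqr_ge0// ler_pdivlMr// mulrC.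
apply: (@le_trans _ _ (L / 16 * z - L / 64 * z ^+ 2)); last exact: lerB.
have : 0 <= L * ((z - 1) * (2 - z)) by rewrite !mulr_ge0 ?subr_ge0// ltW.
have : 0 <= L * z by rewrite mulr_ge0 ?(ltW L0)// (le_trans _ z1).
lra.
Qed.

Lemma sqr_le_expR_sum (R : realType) (scale a b Y Y' : R) :
  0 <= a <= 2 * scale -> b <= (Y + Y') / 2 ->
  a ^+ 2 <= 2 * expR (- b) * (scale ^+ 2 * (expR Y + expR Y')).
Proof.
move=> /andP[a0 a_scale] bY.
have weight_ge1 : 1 <= expR (- b) * expR ((Y + Y') / 2).
  by rewrite -expRD -[leLHS]expR0 ler_expR addrC subr_ge0.
apply: (@le_trans _ _ ((2 * scale) ^+ 2 * (expR (- b) * expR ((Y + Y') / 2)))).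
  by rewrite -[leLHS]mulr1 ler_pM ?sqr_ge0// ler_pXn2r ?nnegrE// (le_trans a0).
have -> : (2 * scale) ^+ 2 * (expR (- b) * expR ((Y + Y') / 2)) =
  2 * expR (- b) * (scale ^+ 2 * (2 * expR ((Y + Y') / 2))) by ring.
by rewrite !ler_wpM2l ?sqr_ge0 ?expR_midpoint_le// mulr_ge0 ?expR_ge0.
Qed.

Section MaximalDisplacement.
Context (R : realType) (V : finType) (p : V -> V -> R) (c f : V -> R).
Variables (o : V) (n : nat) (L : R).
Hypothesis p_ge0 : forall x y, 0 <= p x y.
Hypothesis p_le1 : forall x, \sum_y p x y <= 1.
Hypothesis c_ge0 : forall x, 0 <= c x.
Hypothesis p_rev : forall x y, c x * p x y = c y * p y x.
Hypothesis co : 0 < c o.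
Hypothesis f_ge0 : forall x, 0 <= f x.
Hypothesis fo : f o = 0.
Hypothesis L_gt0 : 0 < L.
Implicit Types (s : seq V) (j r t : nat).

Let energy_ge0 := energy_ge0 f p_ge0.
Let qvar_step_ge0 := qvar_step_ge0 f p_ge0.

(* The factor [2 * n%:R] matches the threshold of [large_steps_window]. *)
Definition large_step j x y : R := (2 ^+ j <= 2 * n%:R * `|incr f x y|)%R%:R.

Definition qvar s : R := \sum_(i < n) qvar_step p f (nth o s i) (nth o s i.+1).

Definition dyadic_tilt j : R := L / 8 / 2 ^+ j.

Let window r r' (T : V -> V -> R) i x y : R := if (r <= i < r'.+1)%N then T x y else 0.

Definition forward_tilt j r r' s : R :=
  large_step j (nth o s r) (nth o s r.+1) *
  expR (\sum_(i < n)
    window r r' (tilt p f (dyadic_tilt j)) i (nth o s i) (nth o s i.+1)).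

(* The tilt of [- f] along the reversed path. *)
Definition backward_tilt j r r' s : R :=
  large_step j (nth o s r') (nth o s r'.+1) *
  expR (\sum_(i < n)
    window r r' (fun x y => tilt p f (- dyadic_tilt j) y x) i (nth o s i) (nth o s i.+1)).

Definition tilt_sum J s : R := \sum_(rr' : 'I_n * 'I_n) \sum_(j < J)
  (2 ^+ j) ^+ 2 * (forward_tilt j rr'.1 rr'.2 s + backward_tilt j rr'.1 rr'.2 s).

Definition total_energy : R := \sum_(i < n.+1) iter i (kact p) (energy p f) o.
Definition energy_mass : R := \sum_x c x * energy p f x.

Lemma large_step_ge0 j x y : 0 <= large_step j x y.
Proof. exact: ler0n. Qed.

Lemma large_stepC j x y : large_step j x y = large_step j y x.
Proof. by rewrite /large_step /incr distrC. Qed.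

Lemma kact_energy_ge0 i x : 0 <= iter i (kact p) (energy p f) x.
Proof. exact: kact_iter_ge0. Qed.

Lemma total_energy_ge0 : 0 <= total_energy.
Proof. by apply: sumr_ge0 => i _; exact: kact_energy_ge0. Qed.

Lemma energy_mass_ge0 : 0 <= energy_mass.
Proof. by apply: sumr_ge0 => x _; rewrite mulr_ge0. Qed.

Lemma large_step_mean_le J x :
  \sum_(j < J) (2 ^+ j) ^+ 2 * (\sum_y p x y * large_step j x y) <=
  8 * n%:R ^+ 2 * energy p f x.
Proof.
under eq_bigr do rewrite mulr_sumr.
rewrite exchange_big mulr_sumr/=; apply: ler_sum => y _.
under eq_bigr do rewrite mulrCA.
rewrite -mulr_sumr mulrCA ler_wpM2l//.
apply: le_trans (sum_dyadic_sqr_le J _) _; first by rewrite !mulr_ge0.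
by rewrite !exprMn real_normK ?num_real//; nra.
Qed.

Lemma forward_tilt_mean_le J r r' : (r < n)%N ->
  \sum_(j < J) (2 ^+ j) ^+ 2 * pathE p n o (forward_tilt j r r') <=
  expR (1 / 2) * (8 * n%:R ^+ 2) * iter r (kact p) (energy p f) o.
Proof.
move=> rn; apply: (@le_trans _ _ (\sum_(j < J) (2 ^+ j) ^+ 2 * (expR (1 / 2) *
    iter r (kact p) (fun x => \sum_y p x y * large_step j x y) o))).
  apply: ler_sum => j _; rewrite ler_wpM2l ?sqr_ge0//.
  apply: (pathE_tilted_after p_ge0 o o (g := large_step j)
    (T := window r r' (tilt p f (dyadic_tilt j)))) => // [i x y ir|x y|i x ri].
  - by rewrite /window leqNgt ir.
  - by rewrite /window; case: ifP => _; rewrite ?tilt_le_half ?divr_ge0.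
  - rewrite /window; case: (r <= i < r'.+1)%N; first exact: sum_expR_tilt_le1.
    by under eq_bigr do rewrite expR0 mulr1.
under eq_bigr do rewrite mulrCA -(kact_iterZ p _ _ r o).
rewrite -mulr_sumr -mulrA ler_wpM2l ?expR_ge0// -kact_iter_sum -(kact_iterZ p _ _ r o).
by apply: le_kact_iter => // x; exact: large_step_mean_le.
Qed.

Lemma backward_tilt_mean_le J r r' : (r' < n)%N ->
  c o * \sum_(j < J) (2 ^+ j) ^+ 2 * pathE p n o (backward_tilt j r r') <=
  expR (1 / 2) * (8 * n%:R ^+ 2) * energy_mass.
Proof.
move=> r'n; rewrite mulr_sumr.
apply: (@le_trans _ _ (\sum_(j < J) (2 ^+ j) ^+ 2 * (expR (1 / 2) *
    \sum_x c x * \sum_y p x y * large_step j y x))).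
  apply: ler_sum => j _; rewrite mulrCA ler_wpM2l ?sqr_ge0//.
  apply: (pathE_tilted_before p_ge0 p_le1 (g := large_step j)
    (T := window r r' (fun x y => tilt p f (- dyadic_tilt j) y x)))
    => // [i x y r'i|x y|i x ir'].
  - by rewrite /window ltnS [(i <= r')%N]leqNgt r'i andbF.
  - by rewrite /window; case: ifP => _; rewrite ?tilt_le_half ?divr_ge0.
  - rewrite /window; case: (r <= i < r'.+1)%N; first exact: sum_expR_tilt_le1.
    by under eq_bigr do rewrite expR0 mulr1.
under eq_bigr do rewrite mulrCA mulr_sumr.
rewrite -mulr_sumr -mulrA ler_wpM2l ?expR_ge0// exchange_big mulr_sumr/=.
apply: ler_sum => x _; under eq_bigr do rewrite mulrCA.
rewrite -mulr_sumr mulrCA ler_wpM2l//; apply: le_trans (large_step_mean_le J x).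
by apply: ler_sum => j _; under eq_bigr do rewrite large_stepC.
Qed.

Lemma tilt_sum_mean_le J : pathE p n o (tilt_sum J) <=
  n%:R ^+ 2 * (expR (1 / 2) * (8 * n%:R ^+ 2) * (total_energy + energy_mass / c o)).
Proof.
pose K : R := expR (1 / 2) * (8 * n%:R ^+ 2).
have K0 : 0 <= K by rewrite !mulr_ge0 ?expR_ge0 ?exprn_ge0.
rewrite pathE_sum; apply: (@le_trans _ _ (\sum_(rr' : 'I_n * 'I_n)
    K * (total_energy + energy_mass / c o))); last first.
  by rewrite sumr_const card_prod card_ord -[leLHS]mulr_natl natrM -expr2.
apply: ler_sum => -[r r'] _; rewrite pathE_sum.
under eq_bigr do rewrite pathEZ pathED mulrDr.
rewrite big_split/= mulrDr; apply: lerD.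
  apply: le_trans (forward_tilt_mean_le _ _ (ltn_ord r)) _; rewrite ler_wpM2l//.
  rewrite /total_energy (bigD1 (widen_ord (leqnSn n) r))//= lerDl.
  by apply: sumr_ge0 => i _; exact: kact_energy_ge0.
by rewrite mulrA ler_pdivlMr// mulrC backward_tilt_mean_le.
Qed.

Lemma qvar_mean_le : pathE p n o qvar <= 3 * total_energy.
Proof.
rewrite /qvar pathE_sum.
apply: (@le_trans _ _ (\sum_(i < n) (2 * iter i (kact p) (energy p f) o +
    iter i.+1 (kact p) (energy p f) o))).
  apply: ler_sum => i _; rewrite !pathED mulr2n mulrDl mul1r.
  apply: lerD; first apply: lerD.
  - apply: (pathE_step_le p_ge0 p_le1 o o (g := fun x y => incr f x y ^+ 2)) => // x y.
    exact: sqr_ge0.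
  - apply: le_trans (pathE_step_le p_ge0 p_le1 o o (g := fun x _ => energy p f x) _ _) _ => //.
    by apply: le_kact_iter => // x; rewrite -mulr_suml ler_piMl.
  - rewrite iterSr; exact: (pathE_step_le p_ge0 p_le1 o o (g := fun _ y => energy p f y)).
rewrite big_split/= -mulr_sumr.
have : \sum_(i < n) iter i (kact p) (energy p f) o <= total_energy.
  by rewrite /total_energy big_ord_recr/= lerDl kact_energy_ge0.
have : \sum_(i < n) iter i.+1 (kact p) (energy p f) o <= total_energy.
  by rewrite /total_energy big_ord_recl/= lerDr.
lra.
Qed.

Lemma qvar_ge0 s : 0 <= qvar s.
Proof. by apply: sumr_ge0 => i _. Qed.

Lemma qvar_window_le s r r' : (r' <= n)%N ->
  \sum_(r <= i < r') qvar_step p f (nth o s i) (nth o s i.+1) <= qvar s.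
Proof.
by move=> r'n; rewrite -(sum_ord_window _ _ r'n); apply: ler_sum => i _; case: ifP.
Qed.

Lemma tilt_sum_term_ge0 j r r' s :
  0 <= (2 ^+ j) ^+ 2 * (forward_tilt j r r' s + backward_tilt j r r' s).
Proof. by rewrite mulr_ge0 ?sqr_ge0// addr_ge0// mulr_ge0 ?large_step_ge0 ?expR_ge0. Qed.

Lemma tilt_sum_ge J j r r' s : (j < J)%N -> (r < n)%N -> (r' < n)%N ->
  (2 ^+ j) ^+ 2 * (forward_tilt j r r' s + backward_tilt j r r' s) <= tilt_sum J s.
Proof.
move=> jJ rn r'n; rewrite /tilt_sum (bigD1 (Ordinal rn, Ordinal r'n))//=.
rewrite (bigD1 (Ordinal jJ))//= -addrA lerDl addr_ge0//.
  by apply: sumr_ge0 => k _; exact: tilt_sum_term_ge0.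
by do 2! (apply: sumr_ge0 => ? _); exact: tilt_sum_term_ge0.
Qed.

Lemma tilt_sum_ge0 J s : 0 <= tilt_sum J s.
Proof. by do 2! (apply: sumr_ge0 => ? _); exact: tilt_sum_term_ge0. Qed.

Lemma sqr_displacement_le_tilt_sum J s t : nth o s 0 = o -> (t <= n)%N ->
  (forall x, f x < 2 ^+ J) ->
  1 <= f (nth o s t) -> L * qvar s <= f (nth o s t) ^+ 2 ->
  f (nth o s t) ^+ 2 <= 2 * expR (1 / 4 - L / 32) * tilt_sum J s.
Proof.
move=> s0 tn fJ; set X := nth o s; set a := f (X t) => a1 qa.
have a_gt0 : 0 < a by apply: lt_le_trans a1.
have [j jJ /andP[ja aj]] := dyadic_scale_exists a1 (fJ (X t)).
have fX0 : f (X 0%N) = 0 by rewrite /X s0.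
have := @large_steps_window _ (fun i => f (X i)) n t tn.
rewrite /= fX0 subr0 -/a => /(_ a_gt0)[r [r' [rr' r't large_r large_r' window_a]]].
have r'n : (r' < n)%N by exact: leq_trans tn.
have large_step_eq1 i : a / (2 * n%:R) <= `|f (X i.+1) - f (X i)| ->
    large_step j (X i) (X i.+1) = 1.
  rewrite ler_pdivrMr ?mulr_gt0 ?ltr0n ?(leq_ltn_trans _ r'n)// => large_i.
  by rewrite /large_step (le_trans ja)// mulrC.
apply: le_trans (ler_wpM2l _ (tilt_sum_ge s jJ (leq_ltn_trans rr' r'n) r'n)); last first.
  by rewrite mulr_ge0 ?expR_ge0.
rewrite /forward_tilt /backward_tilt -/X !large_step_eq1// ![1 * expR _]mul1r.
rewrite /window (sum_ord_window r (fun i => tilt p f (dyadic_tilt j) (X i) (X i.+1)) r'n).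
rewrite (sum_ord_window r (fun i => tilt p f (- dyadic_tilt j) (X i.+1) (X i)) r'n).
have := tilt_path_ge f p_ge0 p_le1 X (dyadic_tilt j) rr'.
set Y := \sum_(r <= i < r'.+1) tilt _ _ _ _ _; set Y' := \sum_(r <= i < r'.+1) tilt _ _ _ _ _.
set Q := \sum_(r <= i < r'.+1) _ => exponent_ge.
have exponent_large : L / 32 - 1 / 4 <= (Y + Y') / 2.
  apply: le_trans exponent_ge; rewrite lerD2r; apply: (tilt_exponent_ge (a := a)) => //.
  - by rewrite ja -exprS ltW.
  - by apply: le_trans qa; rewrite ler_wpM2l ?qvar_window_le// ltW.
have -> : 1 / 4 - L / 32 = - (L / 32 - 1 / 4) by rewrite opprB.
by apply: sqr_le_expR_sum => //; rewrite ltW//= -exprS ltW.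
Qed.

Lemma sqr_displacement_le J s t : nth o s 0 = o -> (t <= n)%N ->
  (forall x, f x < 2 ^+ J) ->
  f (nth o s t) ^+ 2 <= 1 + L * qvar s + 2 * expR (1 / 4 - L / 32) * tilt_sum J s.
Proof.
move=> s0 tn fJ; set a := f _.
have Lq0 : 0 <= L * qvar s by rewrite mulr_ge0 ?qvar_ge0// ltW.
have T0 : 0 <= 2 * expR (1 / 4 - L / 32) * tilt_sum J s.
  by rewrite !mulr_ge0 ?expR_ge0 ?tilt_sum_ge0.
have [a1|a1] := lerP a 1.
  by have : a ^+ 2 <= 1 by [rewrite exprn_ile1// f_ge0]; lra.
have [aq|aq] := leP (a ^+ 2) (L * qvar s); first by lra.
apply: le_trans (sqr_displacement_le_tilt_sum s0 tn fJ (ltW a1) (ltW aq)) _.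
by rewrite -[leLHS]add0r lerD2r addr_ge0.
Qed.

Lemma max_sqr_displacement_le :
  pathE p n o (fun s => \big[Num.max/0]_(x <- s) f x ^+ 2) <=
  1 + 3 * L * total_energy +
  n%:R ^+ 4 * (16 * expR (1 - L / 32)) * (total_energy + energy_mass / c o).
Proof.
have [J fJ] : exists J, forall x, f x < 2 ^+ J.
  pose B := \sum_x f x; exists (Num.bound B) => x.
  have xB : f x <= B by rewrite /B (bigD1 x)//= lerDl sumr_ge0.
  apply: (le_lt_trans xB); apply: (lt_le_trans (archi_boundP _)); first exact: sumr_ge0.
  by rewrite -natrX ler_nat ltnW// ltn_expl.
apply: le_trans (le_pathE p_ge0 (G := fun s => 1 + L * qvar s +
    2 * expR (1 / 4 - L / 32) * tilt_sum J s) _) _.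
  move=> s sn; rewrite big_seq; elim/big_ind: _.
  - by apply: le_trans (sqr_displacement_le (t := 0) (erefl : nth o (o :: s) 0 = o) _ fJ);
      rewrite ?sqr_ge0.
  - by move=> a b aG bG; rewrite ge_max aG.
  - by move=> x /(nthP o)[i]; rewrite /= ltnS sn => ni <-; exact: sqr_displacement_le.
rewrite !pathED !pathEZ; apply: lerD; first apply: lerD.
- exact: pathE_cst_le.
- by rewrite [3 * L]mulrC -mulrA ler_wpM2l ?(ltW L_gt0)// qvar_mean_le.
apply: le_trans (ler_wpM2l _ (tilt_sum_mean_le J)) _; first by rewrite mulr_ge0 ?expR_ge0.
set W := total_energy + _.
have W0 : 0 <= W by rewrite addr_ge0 ?total_energy_ge0 ?divr_ge0 ?energy_mass_ge0.
have -> : 2 * expR (1 / 4 - L / 32) *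
    (n%:R ^+ 2 * (expR (1 / 2) * (8 * n%:R ^+ 2) * W)) =
  n%:R ^+ 4 * (16 * (expR (1 / 4 - L / 32) * expR (1 / 2))) * W by ring.
rewrite ler_wpM2r// ler_wpM2l ?exprn_ge0// ler_wpM2l// -expRD ler_expR; lra.
Qed.

End MaximalDisplacement.

(** * Nonnegative kernels on the natural numbers *)

Section ExtendedReals.
Context (R : realType).
Local Open Scope ereal_scope.
Implicit Types (x : \bar R) (f : nat -> \bar R).

Lemma nneseries_ge_term f k : (forall i, 0 <= f i) -> f k <= \sum_(i <oo) f i.
Proof. by move=> f0; rewrite (@nneseriesD1 _ f k)// leeDl// nneseries_ge0. Qed.

Lemma nneseriesMl x f : 0 <= x -> (forall i, 0 <= f i) ->
  \sum_(i <oo) (x * f i) = x * \sum_(i <oo) f i.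
Proof.
move=> x0 f0; case: x x0 => [r| |] // r0; first by rewrite nneseriesZl.
have [f00|/existsNP[i /eqP fi]] := pselect (forall i, f i = 0).
  by rewrite !eseries0 ?mule0// => i _ _; rewrite f00 ?mule0.
have fi0 : 0 < f i by rewrite lt0e f0 andbT.
rewrite (@gt0_mulye _ (\sum_(i <oo) f i)); last exact: lt_le_trans (nneseries_ge_term i f0).
by apply: (nneseries_pinfty (k := i)) => // [j _|]; rewrite ?mule_ge0// gt0_mulye.
Qed.

Lemma nneseries_supp1 f k : (forall i, 0 <= f i) -> (forall i, i != k -> f i = 0) ->
  \sum_(i <oo) f i = f k.
Proof. by move=> f0 fk; rewrite (@nneseriesD1 _ f k)// eseries0 ?adde0// => i _ /andP[_ /fk]. Qed.

Lemma nneseries_esum_supp (D : set nat) f : (forall z, 0 <= f z) ->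
  (forall z, ~ D z -> f z = 0) -> \sum_(z <oo) f z = \esum_(z in D) f z.
Proof.
move=> f0 fD; rewrite nneseries_esumT// [RHS]esum_mkcond; apply: eq_esum => z _.
by case: ifPn => // /negP zD; rewrite fD// => Dz; apply: zD; rewrite inE.
Qed.

Lemma nneseries_fsum_supp (D : set nat) f : finite_set D -> (forall z, 0 <= f z) ->
  (forall z, ~ D z -> f z = 0) -> \sum_(z <oo) f z = \sum_(z \in D) f z.
Proof. by move=> finD f0 fD; rewrite (nneseries_esum_supp f0 fD) esum_fset. Qed.

Lemma sum_fset_le_nneseries (A : {fset nat}) f : (forall i, 0 <= f i) ->
  \sum_(x : A) f (val x) <= \sum_(i <oo) f i.
Proof. by move=> f0; rewrite -(big_seq_fsetE _ A predT f)/=; exact: lee_sum_fset_lim. Qed.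

Lemma mule_inv_le1 x : 0 <= x -> x / x <= 1.
Proof.
have [->|x0] := eqVneq x 0; first by rewrite mul0e.
case: x x0 => [r| |]// x0 _; last by rewrite invey mule0.
by rewrite divee.
Qed.

Lemma measurable_inve : measurable_fun setT (@inve R).
Proof.
have invE : @inve R = fun x => if x == 0 then +oo else if x == -oo then -oo else
    (fine x * (fine x ^+ 2) `^ (-1))%:E.
  apply/funext => x; case: inveP => [|||r r0]; rewrite ?eqxx//= ?mul0r//.
  by rewrite eqe (negbTE r0) powR_inv1 ?sqr_ge0// expr2 invfM mulrA divff ?mul1r.
have measurable_eqe (a : \bar R) : measurable_fun setT (eq_op^~ a).
  apply: (measurable_fun_bool true); rewrite setTI [X in measurable X](_ : _ = [set a]).
    exact: emeasurable_set1.
  by apply/seteqP; split => x /=; [move/eqP|move=> ->; rewrite eqxx].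
rewrite invE; apply: measurable_fun_ifT => //; apply: measurable_fun_ifT => //.
have mfine : measurable_fun setT (@fine R) by exact: fine_measurable.
apply/measurable_EFinP; apply: measurable_funM => //.
by apply: (measurableT_comp (measurable_powR _)) => //; exact: measurable_funX.
Qed.

End ExtendedReals.

Section ExtendedKernels.
Context (R : realType).
Local Open Scope ereal_scope.
Implicit Types (K L H : nat -> nat -> \bar R) (v w m : nat -> \bar R) (C : set nat).

Definition kacte K v (x : nat) : \bar R := \sum_(z <oo) (K x z * v z).

Definition kcompe K L (x y : nat) : \bar R := kacte K (L^~ y) x.

Definition kide (x y : nat) : \bar R := (x == y)%:R%:E.

Fixpoint kpowe K s : nat -> nat -> \bar R :=
  if s is s'.+1 then kcompe K (kpowe K s') else kide.

Lemma kacte_ge0 K v x : (forall z, 0 <= K x z) -> (forall z, 0 <= v z) -> 0 <= kacte K v x.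
Proof. by move=> K0 v0; apply: nneseries_ge0 => z _ _; exact: mule_ge0. Qed.

Lemma kacteMr K v a x : (forall z, 0 <= K x z) -> (forall z, 0 <= v z) -> 0 <= a ->
  kacte K (fun z => v z * a) x = kacte K v x * a.
Proof.
move=> K0 v0 a0; rewrite muleC -nneseriesMl//; last by move=> z; exact: mule_ge0.
by apply: eq_eseriesr => z _; rewrite muleA muleC.
Qed.

Lemma kacte_swap K L H x y : (forall z, 0 <= K x z) -> (forall z, 0 <= L y z) ->
  (forall z z', 0 <= H z z') ->
  kacte K (fun z => kacte L (H z) y) x = kacte L (fun z => kacte K (H^~ z) x) y.
Proof.
move=> K0 L0 H0; transitivity (\sum_(z <oo) \sum_(z' <oo) (K x z * (L y z' * H z z'))).
  by apply: eq_eseriesr => z _; rewrite nneseriesMl// => z'; rewrite mule_ge0.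
rewrite nneseries_interchange => [|i j]; last by rewrite !mule_ge0.
apply: eq_eseriesr => z _; rewrite -nneseriesMl// => [|z']; last exact: mule_ge0.
by apply: eq_eseriesr => z' _; rewrite muleCA.
Qed.

Lemma kacteA K L v x : (forall z, 0 <= K x z) -> (forall z z', 0 <= L z z') ->
  (forall z, 0 <= v z) -> kacte K (kacte L v) x = kacte (kcompe K L) v x.
Proof.
move=> K0 L0 v0; transitivity (kacte K (fun z => kacte (fun=> v) (L z) 0%N) x).
  by apply: eq_eseriesr => z _; congr (_ * _); apply: eq_eseriesr => y _; rewrite muleC.
rewrite kacte_swap//; apply: eq_eseriesr => y _; exact: muleC.
Qed.

Lemma kide_ge0 x y : 0 <= kide x y.
Proof. by rewrite lee_fin ler0n. Qed.

Lemma kacte_kide v x : (forall z, 0 <= v z) -> kacte kide v x = v x.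
Proof.
move=> v0; rewrite /kacte (nneseries_supp1 (k := x)) => [|z|z zx].
- by rewrite /kide eqxx mul1e.
- by rewrite mule_ge0 ?kide_ge0.
- by rewrite /kide eq_sym (negbTE zx) mul0e.
Qed.

Lemma kpowe_ge0 K s x y : (forall z z', 0 <= K z z') -> 0 <= kpowe K s x y.
Proof.
move=> K0; elim: s x => [|s IH] x; first exact: kide_ge0.
exact: kacte_ge0.
Qed.

Lemma kpoweSr K s x y : (forall z z', 0 <= K z z') ->
  kpowe K s.+1 x y = kcompe (kpowe K s) K x y.
Proof.
move=> K0; elim: s x => [|s IH] x.
  rewrite [RHS]kacte_kide//= /kcompe /kacte (nneseries_supp1 (k := y)) => [|z|z zy].
  - by rewrite /kide eqxx mule1.
  - by rewrite mule_ge0 ?kide_ge0.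
  - by rewrite /kide (negbTE zy) mule0.
transitivity (kacte K (kacte (kpowe K s) (K^~ y)) x).
  by apply: eq_eseriesr => z _; congr (_ * _); exact: IH.
by rewrite kacteA// => z z'; exact: kpowe_ge0.
Qed.

Lemma kpowe_closed K C s x y : (forall z z', C z -> ~ C z' -> K z z' = 0) ->
  C x -> ~ C y -> kpowe K s x y = 0.
Proof.
move=> CK Cx Cy; elim: s x Cx => [|s IH] x Cx.
  by rewrite /= /kide; case: eqP Cx => // ->.
rewrite /= /kcompe /kacte eseries0// => z _ _; have [Cz|Cz] := pselect (C z).
  by rewrite IH// mule0.
by rewrite CK// mul0e.
Qed.

Lemma kpowe_sum_le1 K C s x : (forall z z', 0 <= K z z') ->
  (forall z z', C z -> ~ C z' -> K z z' = 0) -> (forall z, C z -> \sum_(y <oo) K z y <= 1) ->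
  C x -> \sum_(y <oo) kpowe K s x y <= 1.
Proof.
move=> K0 CK K1; elim: s x => [|s IH] x Cx.
  rewrite (nneseries_supp1 (k := x)) => [|z|z zx]; last by rewrite /= /kide eq_sym (negbTE zx).
    by rewrite /= /kide eqxx.
  exact: kide_ge0.
rewrite /= /kcompe nneseries_interchange => [|i j]; last by rewrite mule_ge0 ?kpowe_ge0.
apply: le_trans (K1 x Cx); apply: lee_nneseries => [z _ _|z _].
  by apply: nneseries_ge0 => y _ _; rewrite mule_ge0 ?kpowe_ge0.
rewrite nneseriesMl => [|//|y]; last exact: kpowe_ge0.
have [Cz|Cz] := pselect (C z); last by rewrite CK// mul0e.
by rewrite -[leRHS]mule1 lee_wpmul2l// IH.
Qed.

Lemma kpowe_reversible K m C s x y : (forall z z', 0 <= K z z') -> (forall z, 0 <= m z) ->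
  (forall z z', C z -> ~ C z' -> K z z' = 0) ->
  (forall z z', C z -> C z' -> m z * K z z' = m z' * K z' z) ->
  C x -> C y -> m x * kpowe K s x y = m y * kpowe K s y x.
Proof.
move=> K0 m0 CK revK; elim: s x y => [|s IH] x y Cx Cy.
  by rewrite /= /kide eq_sym; case: eqP => [->//|_]; rewrite !mule0.
rewrite [in RHS]kpoweSr// /= /kcompe /kacte -!nneseriesMl//; last 2 first.
- by move=> z; rewrite mule_ge0 ?kpowe_ge0.
- by move=> z; rewrite mule_ge0 ?kpowe_ge0.
apply: eq_eseriesr => z _; have [Cz|Cz] := pselect (C z).
  by rewrite muleA revK// muleAC IH// -muleA.
by rewrite CK// mul0e mule0 (kpowe_closed (C := C))// mul0e mule0.
Qed.

End ExtendedKernels.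

(** * Transport functions of networks *)

HB.instance Definition _ (R : realType) := gen_eqMixin (network R).
HB.instance Definition _ (R : realType) := gen_choiceMixin (network R).
HB.instance Definition _ (R : realType) := @isPointed.Build (network R)
  (Network (fun _ _ => false) (fun _ _ => 0) (fun _ _ => 0)).

Section Transport.
Context (R : realType).
Local Open Scope ereal_scope.
Implicit Types (N : network R) (F G : network R -> nat -> nat -> \bar R)
  (f g : network R -> nat -> \bar R).

Definition netspace := g_sigma_algebraType (@coord_sets R).

(* Both arguments range over the component of a common root, which, unlike
   [iso_invariant], makes the notion stable under transposition and composition. *)
Definition iso_natural F : Prop := forall N x N' x' phi,
  rooted_iso N x N' x' phi -> forall u v, comp N x u -> comp N x v ->
  F N u v = F N' (phi u) (phi v).

Record transport F : Prop := Transport {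
  transport_ge0 : forall N u v, 0 <= F N u v;
  transport_measurable : forall u v, measurable_fun setT (fun N : netspace => F N u v);
  transport_natural : iso_natural F }.

Definition local_kernel F : Prop := forall N u v, ~ comp N u v -> F N u v = 0.

Lemma comp_refl N u : comp N u u.
Proof. by exists [::]. Qed.

Lemma comp_trans N u v w : comp N u v -> comp N v w -> comp N u w.
Proof.
move=> [s [us <-]] [t [vt <-]]; exists (s ++ t).
by rewrite cat_path us vt last_cat.
Qed.

Lemma comp_adj N u v : adj N u v -> comp N u v.
Proof. by move=> uv; exists [:: v]; rewrite /= uv. Qed.

Lemma transport_cst (a : \bar R) : 0 <= a -> transport (fun _ _ _ => a).
Proof. by move=> a0; split. Qed.

Lemma transport_tr F : transport F -> transport (fun N u v => F N v u).
Proof. by move=> [F0 mF iF]; split => // N x N' x' phi i u v ? ?; exact: iF i _ _ _ _. Qed.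

Lemma transport_diag F : transport F -> transport (fun N u _ => F N u u).
Proof. by move=> [F0 mF iF]; split => // N x N' x' phi i u v ? ?; exact: iF i _ _ _ _. Qed.

Lemma transportM F G : transport F -> transport G ->
  transport (fun N u v => F N u v * G N u v).
Proof.
move=> [F0 mF iF] [G0 mG iG]; split => [N u v|u v|N x N' x' phi i u v xu xv].
- by rewrite mule_ge0.
- exact: emeasurable_funM.
- by rewrite (iF _ _ _ _ _ i)// (iG _ _ _ _ _ i).
Qed.

Lemma transport_map (h : \bar R -> \bar R) F : (forall x, 0 <= x -> 0 <= h x) ->
  measurable_fun setT h -> transport F -> transport (fun N u v => h (F N u v)).
Proof.
move=> h0 mh [F0 mF iF]; split => [N u v|u v|N x N' x' phi i u v xu xv].
- exact: h0.
- exact: measurableT_comp.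
- by rewrite (iF _ _ _ _ _ i).
Qed.

Lemma transportV F : transport F -> transport (fun N u v => (F N u v)^-1).
Proof.
by apply: transport_map => [x|]; [rewrite inve_ge0|exact: measurable_inve].
Qed.

Lemma transport_neq0 F : transport F -> transport (fun N u v => (F N u v != 0)%:R%:E).
Proof.
apply: (transport_map (h := fun x => (x != 0)%:R%:E)) => [x _|].
  by rewrite lee_fin ler0n.
rewrite (_ : (fun x : \bar R => _) = EFin \o \1_(~` [set 0])).
  apply/measurable_EFinP; apply: measurable_indic; apply: measurableC.
  exact: emeasurable_set1.
apply/funext => x /=; rewrite indicE; congr ((nat_of_bool _)%:R%:E).
by apply/idP/idP => [/eqP x0|]; [rewrite inE|rewrite inE => /eqP].
Qed.

Lemma transport_kcompe F G : transport F -> local_kernel F -> transport G ->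
  transport (fun N => kcompe (F N) (G N)).
Proof.
move=> [F0 mF iF] lF [G0 mG iG]; split => [N u v|u v|N x N' x' phi i u v xu xv].
- exact: kacte_ge0.
- apply: ge0_emeasurable_sum => [z N _ _|z _]; first by rewrite mule_ge0.
  exact: emeasurable_funM.
have esum_comp (M : network R) y a b : comp M y a ->
    kcompe (F M) (G M) a b = \esum_(z in comp M y) (F M a z * G M z b).
  move=> ya; apply: nneseries_esum_supp => z; first by rewrite mule_ge0.
  by move=> yz; rewrite lF ?mul0e// => az; apply: yz; exact: comp_trans az.
have [phix inj im iso] := i.
have x'u : comp N' x' (phi u) by rewrite -im; exists u.
rewrite (esum_comp _ x)// (esum_comp _ x')//.
rewrite (reindex_esum (comp N x) (comp N' x') phi).
  by apply: eq_esum => z xz; rewrite (iF _ _ _ _ _ i)// (iG _ _ _ _ _ i).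
by split; [move=> z xz; rewrite /= -im; exists z|by []|rewrite /set_surj -im].
Qed.

Lemma transport_kacte F f : transport F -> local_kernel F ->
  transport (fun N u _ => f N u) -> transport (fun N u _ => kacte (F N) (f N) u).
Proof. exact: transport_kcompe. Qed.

Lemma transport_row_sum F : transport F -> local_kernel F ->
  transport (fun N u _ => \sum_(z <oo) F N u z).
Proof.
move=> tF lF; rewrite (_ : (fun N u _ => _) = fun N u _ => kacte (F N) (fun=> 1) u).
  exact: transport_kacte (transport_cst _).
apply/funext => N; apply/funext => u; apply/funext => _.
by apply: eq_eseriesr => z _; rewrite mule1.
Qed.

Lemma local_kernelM F G : local_kernel F -> local_kernel (fun N u v => F N u v * G N u v).
Proof. by move=> lF N u v /lF ->; rewrite mul0e. Qed.

Lemma local_kernel_closed F N x : local_kernel F ->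
  forall u v, comp N x u -> ~ comp N x v -> F N u v = 0.
Proof. by move=> lF u v xu xv; apply: lF => uv; apply: xv; exact: comp_trans uv. Qed.

Lemma transport_kide : transport (fun=> @kide R).
Proof.
split => [N u v|u v|N x N' x' phi [_ inj _ _] u v xu xv]; rewrite ?kide_ge0//.
rewrite /kide; have -> // : (phi u == phi v) = (u == v).
by apply/eqP/eqP => [/inj|->//]; rewrite !inE; apply.
Qed.

Lemma transport_kpowe F s : transport F -> local_kernel F ->
  transport (fun N => kpowe (F N) s).
Proof.
by move=> tF lF; elim: s => [|s IH]; [exact: transport_kide|exact: transport_kcompe].
Qed.

Lemma local_kpowe F s : local_kernel F -> local_kernel (fun N => kpowe (F N) s).
Proof.
move=> lF N u v uv; apply: (kpowe_closed (C := comp N u)) => //; last exact: comp_refl.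
exact: local_kernel_closed.
Qed.

End Transport.

Section NetworkKernels.
Context (R : realType).
Local Open Scope ereal_scope.
Implicit Types (N : network R).

(* A transport has to be nonnegative, measurable and natural on all networks, not only
   on well-formed ones; the absolute values and the extended sums below ensure it. *)
Definition condE N u v : \bar R := if adj N u v then `|cond N u v|%:E else 0.
Definition sqwtE N u v : \bar R := if adj N u v then (wt N u v ^+ 2)%:E else 0.
Definition degE N u : \bar R := \sum_(z <oo) condE N u z.
Definition stepE N u v : \bar R := condE N u v / degE N u.
Definition powE s N : nat -> nat -> \bar R := kpowe (stepE N) s.
Definition energyE N u : \bar R := kacte (stepE N) (sqwtE N u) u.
Definition reachE s N u v : \bar R := (powE s N u v != 0)%:R%:E.
Definition reach_volE s N u : \bar R := kacte (reachE s N) (degE N) u.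

Lemma measurable_adj u v : measurable_fun setT (fun N : netspace R => adj N u v).
Proof.
apply: (measurable_fun_bool true); rewrite setTI; apply: sub_sigma_algebra.
by exists u, v; left; exists true.
Qed.

Lemma measurable_cond u v : measurable_fun setT (fun N : netspace R => cond N u v).
Proof.
move=> _ B mB; rewrite setTI; apply: sub_sigma_algebra.
by exists u, v; right; exists B; split => //; left.
Qed.

Lemma measurable_wt u v : measurable_fun setT (fun N : netspace R => wt N u v).
Proof.
move=> _ B mB; rewrite setTI; apply: sub_sigma_algebra.
by exists u, v; right; exists B; split => //; right.
Qed.

Lemma transport_cond : transport condE.
Proof.
split => [N u v|u v|N x N' x' phi [_ _ _ iso] u v xu xv].
- by rewrite /condE; case: ifP.
- apply: measurable_fun_ifT => //; first exact: measurable_adj.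
  by apply/measurable_EFinP; apply: measurableT_comp => //; exact: measurable_cond.
- rewrite /condE; have [-> ac] := iso _ _ xu xv.
  by case: ifP => // /ac[->].
Qed.

Lemma local_cond : local_kernel condE.
Proof. by move=> N u v uv; rewrite /condE; case: ifP => // /comp_adj. Qed.

Lemma transport_sqwt : transport sqwtE.
Proof.
split => [N u v|u v|N x N' x' phi [_ _ _ iso] u v xu xv].
- by rewrite /sqwtE; case: ifP => // _; rewrite lee_fin sqr_ge0.
- apply: measurable_fun_ifT => //; first exact: measurable_adj.
  by apply/measurable_EFinP; apply: measurable_funX; exact: measurable_wt.
- rewrite /sqwtE; have [-> ac] := iso _ _ xu xv.
  by case: ifP => // /ac[_ ->].
Qed.

Lemma transport_deg : transport (fun N u _ => degE N u).
Proof. exact: transport_row_sum transport_cond local_cond. Qed.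

Lemma transport_step : transport stepE.
Proof. exact: transportM transport_cond (transportV transport_deg). Qed.

Lemma local_step : local_kernel stepE.
Proof. exact: local_kernelM local_cond. Qed.

Lemma transport_pow s : transport (powE s).
Proof. exact: transport_kpowe transport_step local_step. Qed.

Lemma local_pow s : local_kernel (powE s).
Proof. exact: local_kpowe local_step. Qed.

Lemma transport_energy : transport (fun N u _ => energyE N u).
Proof.
apply: (transport_diag (F := fun N u v => kacte (stepE N) (sqwtE N v) u)).
exact: transport_kcompe transport_step local_step (transport_tr transport_sqwt).
Qed.

Lemma transport_reach s : transport (reachE s).
Proof. exact: transport_neq0 (transport_pow s). Qed.

Lemma local_reach s : local_kernel (reachE s).
Proof. by move=> N u v uv; rewrite /reachE local_pow ?eqxx. Qed.

Lemma transport_reach_vol s : transport (fun N u _ => reach_volE s N u).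
Proof. exact: transport_kacte (transport_reach s) (@local_reach s) transport_deg. Qed.

Lemma condE_ge0 N u v : 0 <= condE N u v.
Proof. exact: (transport_ge0 transport_cond _ _ _). Qed.

Lemma sqwtE_ge0 N u v : 0 <= sqwtE N u v.
Proof. exact: (transport_ge0 transport_sqwt _ _ _). Qed.

Lemma degE_ge0 N u : 0 <= degE N u.
Proof. exact: (transport_ge0 transport_deg N u u). Qed.

Lemma stepE_ge0 N u v : 0 <= stepE N u v.
Proof. exact: (transport_ge0 transport_step _ _ _). Qed.

Lemma powE_ge0 s N u v : 0 <= powE s N u v.
Proof. exact: (transport_ge0 (transport_pow s) _ _ _). Qed.

Lemma energyE_ge0 N u : 0 <= energyE N u.
Proof. exact: (transport_ge0 transport_energy N u u). Qed.

Lemma reachE_ge0 s N u v : 0 <= reachE s N u v.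
Proof. exact: (transport_ge0 (transport_reach s) _ _ _). Qed.

Lemma reach_volE_ge0 s N u : 0 <= reach_volE s N u.
Proof. exact: (transport_ge0 (transport_reach_vol s) N u u). Qed.

End NetworkKernels.

#[local] Hint Extern 0 (is_true (_ <= condE _ _ _)%E) => exact: condE_ge0 : core.
#[local] Hint Extern 0 (is_true (_ <= sqwtE _ _ _)%E) => exact: sqwtE_ge0 : core.
#[local] Hint Extern 0 (is_true (_ <= degE _ _)%E) => exact: degE_ge0 : core.
#[local] Hint Extern 0 (is_true (_ <= stepE _ _ _)%E) => exact: stepE_ge0 : core.
#[local] Hint Extern 0 (is_true (_ <= powE _ _ _ _)%E) => exact: powE_ge0 : core.
#[local] Hint Extern 0 (is_true (_ <= energyE _ _)%E) => exact: energyE_ge0 : core.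
#[local] Hint Extern 0 (is_true (_ <= reachE _ _ _ _)%E) => exact: reachE_ge0 : core.
#[local] Hint Extern 0 (is_true (_ <= reach_volE _ _ _)%E) => exact: reach_volE_ge0 : core.

(** * Reversibility and mass transport *)

Section WellFormed.
Context (R : realType).
Local Open Scope ereal_scope.
Variables (N : network R) (rho : nat).
Hypothesis wfN : wf_network N rho.

Lemma finite_nbrs u : comp N rho u -> finite_set (nbrs N u).
Proof. by move=> /wfN[]. Qed.

Lemma comp_adj_trans u v : comp N rho u -> adj N u v -> comp N rho v.
Proof. by move=> ru uv; apply: comp_trans ru _; exact: comp_adj. Qed.

Lemma condE_wf u v : comp N rho u -> adj N u v -> condE N u v = (cond N u v)%:E.
Proof.
move=> /wfN[_ wu] uv; have [_ _ c0 _ _] := wu v uv.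
by rewrite /condE uv ger0_norm.
Qed.

Lemma condE_nadj u v : ~~ adj N u v -> condE N u v = 0.
Proof. by rewrite /condE => /negbTE ->. Qed.

Lemma degE_wf u : comp N rho u -> degE N u = (cdeg N u)%:E.
Proof.
move=> ru; rewrite /degE (nneseries_fsum_supp (finite_nbrs ru))// => [|z /negP uz].
  rewrite -fsumEFin; last exact: finite_nbrs.
  by apply: eq_fsbigr => v; rewrite inE => uv; rewrite condE_wf.
exact: condE_nadj.
Qed.

Lemma cdeg_ge0 u : comp N rho u -> (0 <= cdeg N u)%R.
Proof. by move=> ru; rewrite -lee_fin -degE_wf. Qed.

Lemma cond_le_cdeg u v : comp N rho u -> adj N u v -> (cond N u v <= cdeg N u)%R.
Proof.
by move=> ru uv; rewrite -lee_fin -degE_wf// -condE_wf//; exact: nneseries_ge_term.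
Qed.

Lemma cdeg_step u v : comp N rho u -> adj N u v -> (cdeg N u * step N u v = cond N u v)%R.
Proof.
move=> ru uv; rewrite /step uv.
have [c0|c0] := eqVneq (cdeg N u) 0%R; last by rewrite mulrC divfK.
have [_ /(_ v uv)[_ _ cuv _ _]] := wfN ru.
by apply/eqP; rewrite c0 mul0r eq_le cuv -c0 cond_le_cdeg.
Qed.

Lemma stepE_wf u v : comp N rho u -> stepE N u v = (step N u v)%:E.
Proof.
move=> ru; rewrite /stepE; have [uv|uv] := boolP (adj N u v); last first.
  by rewrite condE_nadj// mul0e /step (negbTE uv).
rewrite condE_wf// degE_wf// inver /step uv; case: eqP => // c0.
by rewrite -cdeg_step// c0 !mul0r mul0e.
Qed.

Lemma step_ge0 u v : comp N rho u -> (0 <= step N u v)%R.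
Proof. by move=> ru; rewrite -lee_fin -stepE_wf. Qed.

Lemma kacte_step u (v : nat -> \bar R) : comp N rho u -> (forall z, 0 <= v z) ->
  kacte (stepE N) v u = \sum_(z \in nbrs N u) ((step N u z)%:E * v z).
Proof.
move=> ru v0; rewrite /kacte (nneseries_fsum_supp (finite_nbrs ru)) => [|z|z /negP uz].
- by apply: eq_fsbigr => z _; rewrite stepE_wf.
- exact: mule_ge0.
- by rewrite /stepE condE_nadj// !mul0e.
Qed.

Lemma energyE_wf u : comp N rho u ->
  energyE N u = (\sum_(y \in nbrs N u) step N u y * wt N u y ^+ 2)%R%:E.
Proof.
move=> ru; rewrite /energyE kacte_step// -fsumEFin; last exact: finite_nbrs.
by apply: eq_fsbigr => y; rewrite inE => uy; rewrite EFinM /sqwtE uy.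
Qed.

Lemma stepE_sum_le1 u : \sum_(z <oo) stepE N u z <= 1.
Proof.
under eq_eseriesr do rewrite /stepE muleC.
by rewrite nneseriesMl ?inve_ge0// -/(degE N u) muleC mule_inv_le1.
Qed.

Lemma powE_sum_le1 s u : \sum_(z <oo) powE s N u z <= 1.
Proof.
apply: (kpowe_sum_le1 (C := comp N u)) => //; last exact: comp_refl.
  exact: local_kernel_closed (@local_step R).
by move=> z _; exact: stepE_sum_le1.
Qed.

Lemma powE0_refl u : powE 0 N u u = 1.
Proof. by rewrite /powE /= /kide eqxx. Qed.

Lemma powE_fin_num s u v : powE s N u v \is a fin_num.
Proof.
rewrite ge0_fin_numE// (@le_lt_trans _ _ 1) ?ltry//.
by apply: le_trans (powE_sum_le1 s u); exact: nneseries_ge_term.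
Qed.

Lemma adj_sym u v : comp N rho u -> comp N rho v -> adj N u v = adj N v u.
Proof.
move=> ru rv; apply/idP/idP => [uv|vu].
  by have [_ /(_ v uv)[]] := wfN ru.
by have [_ /(_ u vu)[]] := wfN rv.
Qed.

Lemma step_reversible u v : comp N rho u -> comp N rho v ->
  (cdeg N u * step N u v = cdeg N v * step N v u)%R.
Proof.
move=> ru rv; have [uv|uv] := boolP (adj N u v).
  rewrite !cdeg_step -?(adj_sym ru rv)//.
  by have [_ /(_ v uv)[]] := wfN ru.
by rewrite /step -(adj_sym ru rv) (negbTE uv) !mulr0.
Qed.

Lemma powE_reversible s u v : comp N rho u -> comp N rho v ->
  degE N u * powE s N u v = degE N v * powE s N v u.
Proof.
apply: (kpowe_reversible (C := comp N rho)) => //.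
  exact: local_kernel_closed (@local_step R).
by move=> {}u {}v ru rv; rewrite !degE_wf// !stepE_wf// -!EFinM step_reversible.
Qed.

End WellFormed.

Section TransportedEnergy.
Context (R : realType).
Local Open Scope ereal_scope.
Implicit Types (N : network R) (s : nat).

Definition mean_energy s N u : \bar R := kacte (powE s N) (energyE N) u.

Definition reached_energy s N u : \bar R :=
  kacte (reachE s N) (fun y => degE N y * energyE N y) u.

(* Transported along the [s]-step walk, the factor [(powE s N u v)^-1] turns the sum over
   the walk into a sum over the set it reaches in [s] steps, by detailed balance. *)
Definition energy_share s N u v : \bar R :=
  degE N v * energyE N v / powE s N u v / reach_volE s N v.

Definition mean_share s N u : \bar R := kacte (powE s N) (energy_share s N u) u.

Lemma energy_share_ge0 s N u v : 0 <= energy_share s N u v.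
Proof. by rewrite !mule_ge0 ?inve_ge0. Qed.

Lemma mean_energy_ge0 s N u : 0 <= mean_energy s N u.
Proof. exact: kacte_ge0. Qed.

Lemma mean_energyS s N u : mean_energy s.+1 N u = kacte (stepE N) (mean_energy s N) u.
Proof. by rewrite [RHS]kacteA// => z z'; exact: powE_ge0. Qed.

Lemma mean_share_ge0 s N u : 0 <= mean_share s N u.
Proof. by apply: kacte_ge0 => // y; exact: energy_share_ge0. Qed.

Lemma transport_energy_share s : transport (@energy_share s).
Proof.
apply: transportM (transportV (transport_tr (transport_reach_vol _ s))).
apply: transportM (transportV (transport_pow _ s)).
exact: transportM (transport_tr (transport_deg _)) (transport_tr (transport_energy _)).
Qed.

Lemma transport_mean_energy s : transport (fun N u _ => mean_energy s N u).
Proof. exact: transport_kacte (transport_pow _ s) (@local_pow R s) (transport_energy _). Qed.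

Lemma transport_mean_share s : transport (fun N u _ => mean_share s N u).
Proof.
apply: (transport_diag (F := fun N u v => kacte (powE s N) (energy_share s N v) u)).
apply: transport_kcompe (transport_pow _ s) (@local_pow R s) _.
exact: transport_tr (transport_energy_share s).
Qed.

Lemma received_share_le N rho s : wf_network N rho ->
  kacte (powE s N) (fun y => energy_share s N y rho) rho <= energyE N rho.
Proof.
move=> wfN; have cr := comp_refl N rho.
have a0 : 0 <= energyE N rho / reach_volE s N rho by rewrite mule_ge0 ?inve_ge0.
apply: (@le_trans _ _ (reach_volE s N rho * (energyE N rho / reach_volE s N rho))); last first.
  by rewrite muleCA -[leRHS]mule1 lee_wpmul2l// mule_inv_le1.
rewrite -kacteMr//; apply: lee_nneseries => [y _ _|y _].
  by rewrite mule_ge0// energy_share_ge0.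
have [->|pow_neq0] := eqVneq (powE s N rho y) 0; first by rewrite mul0e mule_ge0// mule_ge0.
have ry : comp N rho y.
  by apply: contrapT => ry; move: pow_neq0; rewrite local_pow// eqxx.
have -> : powE s N rho y * energy_share s N y rho =
    degE N rho * powE s N rho y / powE s N y rho * (energyE N rho / reach_volE s N rho).
  by rewrite /energy_share -!muleA [LHS]muleCA; congr (_ * (_ * _)); exact: muleCA.
rewrite /reachE pow_neq0 mul1e lee_wpmul2r// (powE_reversible wfN)// -muleA.
by rewrite -[leRHS]mule1 lee_wpmul2l// mule_inv_le1.
Qed.

End TransportedEnergy.

Section MassTransport.
Context (R : realType) (d : measure_display) (Omega : measurableType d)
  (P : probability Omega R) (net : Omega -> network R) (rt : Omega -> nat).
Hypothesis rnet : random_network net rt.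
Hypothesis rev : reversible P net rt.
Local Open Scope ereal_scope.

Lemma random_network_wf w : wf_network (net w) (rt w).
Proof. by case: rnet. Qed.

Lemma measurable_net : measurable_fun setT (net : Omega -> netspace R).
Proof.
have [_ madj mcond mwt _] := rnet.
apply: (@measurability _ _ _ (netspace R) setT net (@coord_sets R) erefl)
  => _ [A [u [v [[b ->]|[B [mB [->|->]]]]]] <-];
  rewrite setTI; [exact: madj|exact: mcond|exact: mwt].
Qed.

Lemma measurable_transport_root F : transport F ->
  measurable_fun setT (fun w => F (net w) (rt w) (rt w)).
Proof.
move=> [_ mF _] _ B mB; rewrite setTI.
have [mrt _ _ _ _] := rnet.
rewrite [X in measurable X](_ : _ = \bigcup_k (rt @^-1` [set k] `&`
   (fun w => F (net w) k k) @^-1` B)); last first.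
  apply/seteqP; split => [w Bw|w [k _ [/= <-]]//].
  by exists (rt w).
apply: bigcup_measurable => k _; apply: measurableI; first exact: mrt.
rewrite -[X in measurable X]setTI.
exact: (measurableT_comp (mF k k) measurable_net).
Qed.

Lemma mass_transport_step F : transport F ->
  \int[P]_w kacte (stepE (net w)) (F (net w) (rt w)) (rt w) =
  \int[P]_w kacte (stepE (net w)) (fun y => F (net w) y (rt w)) (rt w).
Proof.
move=> [F0 mF iF]; have [_ /(_ F F0) exchange] := rev.
have cr w := comp_refl (net w) (rt w).
under eq_integral => w _ do rewrite (kacte_step (@random_network_wf w))//.
under [RHS]eq_integral => w _ do rewrite (kacte_step (@random_network_wf w))//.
apply: exchange.
  by move=> x y B mB; have := mF x y measurableT B mB; rewrite setTI.
by move=> N x y N' x' phi i xy; apply: iF i _ _ _ _ => //; exact: comp_refl.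
Qed.

Lemma mass_transport s F : transport F ->
  \int[P]_w kacte (powE s (net w)) (F (net w) (rt w)) (rt w) =
  \int[P]_w kacte (powE s (net w)) (fun y => F (net w) y (rt w)) (rt w).
Proof.
elim: s F => [|s IH] F tF; have F0 := transport_ge0 tF.
  by apply: eq_integral => w _; rewrite !kacte_kide.
pose G N x z := kacte (powE s N) (F N x) z.
have G0 N x z : 0 <= G N x z by exact: kacte_ge0.
have tG : transport G.
  exact: (transport_tr (transport_kcompe (transport_pow _ s) (@local_pow R s) (transport_tr tF))).
have tH : transport (fun N => kcompe (stepE N) (F N)).
  exact: transport_kcompe (transport_step _) (@local_step R) tF.
transitivity (\int[P]_w kacte (stepE (net w)) (G (net w) (rt w)) (rt w)).
  by apply: eq_integral => w _; rewrite kacteA.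
rewrite (mass_transport_step tG).
transitivity (\int[P]_w kacte (powE s (net w))
    (kcompe (stepE (net w)) (F (net w)) (rt w)) (rt w)).
  by apply: eq_integral => w _; rewrite kacte_swap.
rewrite (IH _ tH); apply: eq_integral => w _; rewrite kacteA//.
by apply: eq_eseriesr => y _; congr (_ * _); exact/esym/kpoweSr.
Qed.

Lemma integral_energyE : \int[P]_w energyE (net w) (rt w) = \int[P]_w
  (\sum_(y \in nbrs (net w) (rt w)) step (net w) (rt w) y * wt (net w) (rt w) y ^+ 2)%R%:E.
Proof.
apply: eq_integral => w _; exact: (energyE_wf (@random_network_wf w) (comp_refl _ _)).
Qed.

Lemma le_integral_root F G : transport F -> transport G ->
  (forall w, F (net w) (rt w) (rt w) <= G (net w) (rt w) (rt w)) ->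
  \int[P]_w F (net w) (rt w) (rt w) <= \int[P]_w G (net w) (rt w) (rt w).
Proof.
move=> tF tG FG; apply: ge0_le_integral => [//|w _|||w _].
- exact: transport_ge0.
- exact: measurable_transport_root.
- exact: measurable_transport_root.
- exact: FG.
Qed.

Lemma integral_mean_energy_le s :
  \int[P]_w mean_energy s (net w) (rt w) <= \int[P]_w energyE (net w) (rt w).
Proof.
have t_en := transport_tr (transport_energy R).
rewrite (mass_transport s t_en).
apply: (le_integral_root (transport_kcompe (transport_pow R s) (@local_pow R s) t_en)
  (transport_energy R)) => w.
rewrite /kcompe /kacte; under eq_eseriesr do rewrite muleC.
by rewrite nneseriesMl// -[leRHS]mule1 lee_wpmul2l// powE_sum_le1.
Qed.

Lemma integral_mean_share_le s :
  \int[P]_w mean_share s (net w) (rt w) <= \int[P]_w energyE (net w) (rt w).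
Proof.
have t_share := transport_energy_share R s.
rewrite (mass_transport s t_share).
apply: (le_integral_root (transport_kcompe (transport_pow R s) (@local_pow R s) t_share)
  (transport_energy R)) => w.
by apply: received_share_le; exact: random_network_wf.
Qed.

End MassTransport.

(** * Weighted distances and balls *)

Section WeightedDistance.
Context (R : realType).
Variables (N : network R) (rho : nat).
Hypothesis wfN : wf_network N rho.

Lemma pathwt_rcons x s y : pathwt N x (rcons s y) = pathwt N x s + wt N (last x s) y.
Proof. by elim: s x => [|z s IH] x /=; rewrite ?addr0 ?add0r// IH addrA. Qed.

Lemma pathwt_ge0 x s : comp N rho x -> path (adj N) x s -> 0 <= pathwt N x s.
Proof.
elim: s x => [//|y s IH] x rx /= /andP[xy ys].
have [_ /(_ y xy)[_ _ _ _ w0]] := wfN rx.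
by rewrite addr_ge0// IH//; exact: comp_adj_trans xy.
Qed.

Lemma wdist_le y s : path (adj N) rho s -> last rho s = y ->
  wdist N rho y <= pathwt N rho s.
Proof.
move=> ps ls; apply: ge_inf; last by exists s.
exists 0 => _ [t [pt _ ->]]; apply: pathwt_ge0 pt; exact: comp_refl.
Qed.

Lemma le_wdist y (a : R) : comp N rho y ->
  (forall s, path (adj N) rho s -> last rho s = y -> a <= pathwt N rho s) ->
  a <= wdist N rho y.
Proof.
move=> [s [ps ls]] a_le; apply: lb_le_inf; first by exists (pathwt N rho s), s.
by move=> _ [t [pt lt ->]]; exact: a_le.
Qed.

Lemma wdist_ge0 y : comp N rho y -> 0 <= wdist N rho y.
Proof. by move=> ry; apply: le_wdist => // s ps _; apply: pathwt_ge0 ps; exact: comp_refl. Qed.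

Lemma wdist_root : wdist N rho rho = 0.
Proof.
apply/eqP; rewrite eq_le wdist_ge0 ?andbT; last exact: comp_refl.
exact: (@wdist_le rho [::]).
Qed.

Lemma wdist_adj_le x y : comp N rho x -> adj N x y ->
  wdist N rho y <= wdist N rho x + wt N x y.
Proof.
move=> rx xy; rewrite -lerBlDr; apply: le_wdist => // s ps ls.
rewrite lerBlDr; have := @wdist_le y (rcons s y).
by rewrite pathwt_rcons ls; apply; rewrite ?last_rcons// rcons_path ps ls.
Qed.

Lemma sqr_wdist_incr_le x y : comp N rho x -> adj N x y ->
  (wdist N rho y - wdist N rho x) ^+ 2 <= wt N x y ^+ 2.
Proof.
move=> rx xy; have ry := comp_adj_trans rx xy.
have [_ /(_ y xy)[yx _ _ wxy w0]] := wfN rx.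
rewrite -[leLHS]real_normK ?num_real// ler_pXn2r ?nnegrE// ler_norml.
have := wdist_adj_le rx xy; have := wdist_adj_le ry yx; rewrite -wxy.
by move=> xle yle; apply/andP; split; lra.
Qed.

End WeightedDistance.

Section Volume.
Context (R : realType).
Variables (N : network R) (rho : nat).
Hypothesis wfN : wf_network N rho.

Lemma sub_gball x r r' : (r <= r')%N -> gball N x r `<=` gball N x r'.
Proof. by move=> rr' y [s [ps ls sr]]; exists s; split => //; exact: leq_trans rr'. Qed.

Lemma gball_trans x y z r r' : gball N x r y -> gball N y r' z -> gball N x (r + r') z.
Proof.
move=> [s [ps ls sr]] [t [pt lt tr]]; exists (s ++ t).
by rewrite cat_path ps ls pt last_cat ls lt size_cat leq_add.
Qed.

Lemma gball_comp x r : gball N x r `<=` comp N x.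
Proof. by move=> y [s [ps ls _]]; exists s. Qed.

Lemma gball_finite x r : comp N rho x -> finite_set (gball N x r).
Proof.
elim: r x => [|r IH] x rx.
  apply: (@sub_finite_set _ _ [set x]) => //.
  by move=> y [s [_ <-]]; rewrite leqn0 => /nilP ->.
apply: (@sub_finite_set _ _ ([set x] `|` \bigcup_(z in nbrs N x) gball N z r)).
  move=> y [[|z s] [/= ps ls sr]]; first by left.
  by right; case/andP: ps => xz zs; exists z => //; exists s.
rewrite finite_setU; split => //; apply: bigcup_finite; first exact: finite_nbrs wfN _ rx.
by move=> z xz; apply: IH; exact: comp_adj_trans xz.
Qed.

Let gball_root_finite r : finite_set (gball N rho r).
Proof. exact: gball_finite (comp_refl _ _). Qed.

Let cdeg_gball_ge0 r y : gball N rho r y -> 0 <= cdeg N y.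
Proof. by move=> /gball_comp; exact: cdeg_ge0. Qed.

Lemma vol_ge0 r : 0 <= vol N rho r.
Proof. by apply: fsumr_ge0 => y; exact: cdeg_gball_ge0. Qed.

Lemma le_vol r r' : (r <= r')%N -> vol N rho r <= vol N rho r'.
Proof.
move=> rr'; rewrite -lee_fin /vol -!fsumEFin//.
apply: lee_fsum_nneg_subset => // [y|y].
  by rewrite !inE; exact: sub_gball.
by move=> /andP[_ /set_mem ry]; rewrite lee_fin (cdeg_gball_ge0 ry).
Qed.

Lemma powE_neq0_gball s u v : powE s N u v != 0%E -> gball N u s v.
Proof.
elim: s u => [|s IH] u.
  by rewrite /powE /= /kide; case: (u =P v) => [-> _|]; [exists [::]|rewrite eqxx].
have [term0|/existsNP[z /eqP z_neq0 _]] :=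
    pselect (forall z, (stepE N u z * powE s N z v = 0)%E).
  by rewrite /powE/= /kcompe /kacte eseries0 ?eqxx// => z _ _; exact: term0.
have uz : adj N u z.
  by apply: contra_neqT z_neq0 => uz; rewrite /stepE condE_nadj// !mul0e.
have [t [pt lt ts]] : gball N z s v.
  by apply: IH; apply: contra_neq z_neq0 => ->; rewrite mule0.
by exists (z :: t); rewrite /= uz.
Qed.

Lemma powE_neq0_comp s u v : powE s N u v != 0%E -> comp N u v.
Proof. by move=> /powE_neq0_gball /gball_comp. Qed.

Lemma powE_neq0_step s u v w : comp N rho u -> powE s N u v != 0%E -> step N v w != 0 ->
  powE s.+1 N u w != 0%E.
Proof.
move=> ru pow_neq0 step_neq0.
have rv : comp N rho v by apply: comp_trans ru _; exact: powE_neq0_comp pow_neq0.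
have term_gt0 : (0 < powE s N u v * stepE N v w)%E.
  rewrite lt0e mule_ge0// andbT mule_eq0 negb_or pow_neq0 (stepE_wf wfN)//.
suff : (0 < powE s.+1 N u w)%E by rewrite lt0e => /andP[].
rewrite /powE kpoweSr//; apply: lt_le_trans term_gt0 _.
by apply: (@nneseries_ge_term _ (fun z => powE s N u z * stepE N z w)%E) => z; exact: mule_ge0.
Qed.

Lemma reach_volE_le_vol s y : powE s N rho y != 0%E ->
  (reach_volE s N y <= (vol N rho (s + s))%:E)%E.
Proof.
move=> /powE_neq0_gball ry.
rewrite /reach_volE /kacte (nneseries_fsum_supp (gball_root_finite (s + s))) => [|z|z].
- rewrite /vol -fsumEFin//; apply: lee_fsum => // z rz.
  rewrite (degE_wf wfN) /reachE; last exact: gball_comp rz.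
  have c0 : (0 <= (cdeg N z)%:E)%E by rewrite lee_fin (cdeg_gball_ge0 rz).
  by case: (_ == _); rewrite ?mul0e ?mul1e.
- exact: mule_ge0.
- move=> rz; suff -> : reachE s N y z = 0%E by rewrite mul0e.
  rewrite /reachE; case: eqP => // /eqP /powE_neq0_gball yz.
  by exfalso; apply: rz; exact: gball_trans yz.
Qed.

Lemma reach_volE_gt0 s y : 0 < cdeg N rho -> powE s N rho y != 0%E ->
  (0 < reach_volE s N y)%E.
Proof.
move=> c0 pow_neq0; have cr := comp_refl N rho.
have deg_gt0 : (0 < degE N rho)%E by rewrite (degE_wf wfN).
have back_neq0 : powE s N y rho != 0%E.
  have := powE_reversible wfN s cr (powE_neq0_comp pow_neq0).
  by apply: contra_eq_neq => ->; rewrite mule0 mule_eq0 negb_or pow_neq0 gt_eqF.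
apply: lt_le_trans (@nneseries_ge_term _ (fun z => reachE s N y z * degE N z)%E rho _).
  by rewrite /reachE back_neq0 mul1e.
by move=> z; rewrite mule_ge0.
Qed.

Lemma reached_energy_le s : 0 < cdeg N rho ->
  (reached_energy s N rho <= (vol N rho (s + s))%:E * mean_share s N rho)%E.
Proof.
move=> c0; have share0 y := energy_share_ge0 s N rho y.
rewrite -nneseriesMl ?lee_fin ?vol_ge0// => [|y]; last exact: mule_ge0.
apply: lee_nneseries => [y _ _|y _]; first by rewrite mule_ge0// mule_ge0.
have [pow0|pow_neq0] := eqVneq (powE s N rho y) 0%E.
  by rewrite /reachE pow0 eqxx !mul0e mule0.
have volrv := reach_volE_le_vol pow_neq0.
have rv_gt0 := reach_volE_gt0 c0 pow_neq0.
have rv_fin : reach_volE s N y \is a fin_num.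
  by rewrite ge0_fin_numE// (le_lt_trans volrv) ?ltry.
set D := (degE N y * energyE N y)%E.
have -> : (powE s N rho y * energy_share s N rho y = D / reach_volE s N y)%E.
  rewrite /energy_share -/D muleA [(powE s N rho y * _)%E]muleCA.
  by rewrite divee ?mule1 ?powE_fin_num.
rewrite /reachE pow_neq0 mul1e muleCA -[leLHS]mule1; apply: lee_wpmul2l.
  exact: mule_ge0.
rewrite -(divee rv_fin) ?gt_eqF//; apply: lee_wpmul2r => //.
by rewrite inve_ge0.
Qed.

Lemma sum_reached_energy_le n : 0 < cdeg N rho ->
  (\sum_(i < n.+1) reached_energy i N rho <=
   (vol N rho (n + n))%:E * \sum_(i < n.+1) mean_share i N rho)%E.
Proof.
move=> c0; rewrite ge0_sume_distrr => [|i _]; last exact: mean_share_ge0.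
apply: lee_sum => i _; apply: (le_trans (reached_energy_le i c0)).
by rewrite lee_wpmul2r ?mean_share_ge0// lee_fin le_vol// leq_add// -ltnS.
Qed.

Lemma vol_subexponential (e : R) : 0 < e ->
  (fun r : nat => ln (ln (vol N rho r)) / ln r%:R) @ \oo --> (0 : R) ->
  exists r0, forall r, (r0 <= r)%N -> vol N rho r <= expR (r%:R `^ e).
Proof.
move=> e0 /cvgrPdist_le /(_ _ e0)[r0 _ small]; exists (maxn r0 2) => r.
rewrite geq_max => /andP[/small + r2]; rewrite /= sub0r normrN => small_r.
have [vol_le1|vol_gt1] := leP (vol N rho r) 1.
  by rewrite (le_trans vol_le1)// -expR0 ler_expR powR_ge0.
have lnr_gt0 : 0 < ln (r%:R : R) by rewrite ln_gt0// ltr1n.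
have loglog_le : ln (ln (vol N rho r)) <= e * ln r%:R.
  by rewrite -ler_pdivrMr//; apply: le_trans small_r; exact: ler_norm.
rewrite -[leLHS]lnK ?posrE ?(lt_trans ltr01)// ler_expR -[leLHS]lnK ?posrE ?ln_gt0//.
by rewrite /powR gt_eqF ?ler_expR// ltr0n; exact: ltnW.
Qed.

End Volume.

(** * Reduction to a finite chain *)

Section ReachedSet.
Context (R : realType).
Variables (N : network R) (rho n : nat).
Hypothesis wfN : wf_network N rho.

Definition reached : set nat := [set x | exists2 s, (s <= n)%N & powE s N rho x != 0%E].

Lemma reached_comp : reached `<=` comp N rho.
Proof. by move=> x [s _ /powE_neq0_comp]. Qed.

Lemma reached_finite : finite_set reached.
Proof.
apply: sub_finite_set (gball_finite wfN n (comp_refl N rho)) => x [s sn /powE_neq0_gball].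
exact: sub_gball.
Qed.

Let V : {fset nat} := fset_set reached.

Let V_reached (x : V) : reached (val x).
Proof. by have := valP x; rewrite in_fset_set ?inE//; exact: reached_finite. Qed.

Let V_comp (x : V) : comp N rho (val x).
Proof. exact: reached_comp. Qed.

Let root_in_V : rho \in V.
Proof.
rewrite in_fset_set ?inE; last exact: reached_finite.
by exists 0%N; rewrite ?powE0_refl ?onee_neq0.
Qed.

Let o : V := [` root_in_V]%fset.
Let p (x y : V) : R := step N (val x) (val y).
Let c (x : V) : R := cdeg N (val x).
Let f (x : V) : R := wdist N rho (val x).

Let p_ge0 x y : 0 <= p x y.
Proof. exact: (step_ge0 wfN). Qed.

Let p_le1 x : \sum_y p x y <= 1.
Proof.
rewrite -lee_fin -sumEFin; apply: le_trans (stepE_sum_le1 N (val x)).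
under eq_bigr do rewrite -(stepE_wf wfN)//.
exact: sum_fset_le_nneseries.
Qed.

Let p_rev x y : c x * p x y = c y * p y x.
Proof. exact: (step_reversible wfN). Qed.

Lemma walkE_pathE m s (x : V) (F : seq nat -> R) : (s + m <= n)%N ->
  powE s N rho (val x) != 0%E ->
  walkE N m (val x) F = pathE p m x (fun t => F (map val t)).
Proof.
elim: m s x F => [//|m IH] s x F sm pow_neq0 /=.
pose g y := step N (val x) y * walkE N m y (fun t => F (val x :: t)).
have reached_step y : step N (val x) y != 0 -> reached y.
  move=> step_neq0; exists s.+1; first by apply: leq_trans sm; rewrite addnS ltnS leq_addr.
  exact: (powE_neq0_step wfN (comp_refl _ _) pow_neq0).
transitivity (\sum_(y \in nbrs N (val x) `|` reached) g y).
  apply: fsbig_widen; first by move=> y; left.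
  by move=> y [_ /= /negP ny]; rewrite /g /step (negbTE ny) mul0r.
transitivity (\sum_(y \in reached) g y).
  apply/esym; apply: fsbig_widen; first by move=> y; right.
  move=> y [_ /= ny]; rewrite /g; have [->|/reached_step//] := eqVneq (step N (val x) y) 0.
  by rewrite mul0r.
rewrite fsbig_finite; last exact: reached_finite.
rewrite big_seq_fsetE/=; apply: eq_bigr => y _.
rewrite /g -/(p x y); have [->|p_neq0] := eqVneq (p x y) 0; first by rewrite !mul0r.
congr (_ * _); apply: (IH s.+1); first by rewrite addSn -addnS.
exact: (powE_neq0_step wfN (comp_refl _ _) pow_neq0).
Qed.

Lemma energy_le_energyE (x : V) : ((energy p f x)%:E <= energyE N (val x))%E.
Proof.
apply: le_trans (sum_fset_le_nneseries V
  (fun y => mule_ge0 (stepE_ge0 N (val x) y) (sqwtE_ge0 N (val x) y))).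
rewrite -sumEFin; apply: lee_sum => y _; rewrite (stepE_wf wfN)// EFinM.
have [xy|xy] := boolP (adj N (val x) (val y)); last by rewrite /p /step (negbTE xy) !mul0e.
rewrite lee_wpmul2l ?lee_fin// /sqwtE xy lee_fin.
exact: (sqr_wdist_incr_le wfN).
Qed.

Lemma kact_energy_le_mean_energy i (x : V) :
  ((iter i (kact p) (energy p f) x)%:E <= mean_energy i N (val x))%E.
Proof.
elim: i x => [|i IH] x; first by rewrite /mean_energy kacte_kide//; exact: energy_le_energyE.
rewrite -[iter i.+1 _ _ x]/(\sum_y p x y * iter i (kact p) (energy p f) y) -sumEFin.
rewrite mean_energyS; apply: le_trans (sum_fset_le_nneseries V (fun y =>
  mule_ge0 (stepE_ge0 N (val x) y) (mean_energy_ge0 i N y))).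
by apply: lee_sum => y _; rewrite EFinM (stepE_wf wfN)// lee_wpmul2l ?lee_fin.
Qed.

Lemma total_energy_le_mean_energy :
  ((total_energy p f o n)%:E <= \sum_(i < n.+1) mean_energy i N rho)%E.
Proof.
rewrite /total_energy -sumEFin; apply: lee_sum => i _.
exact: (kact_energy_le_mean_energy i o).
Qed.

Lemma energy_mass_le_reached_energy :
  ((energy_mass p c f)%:E <= \sum_(i < n.+1) reached_energy i N rho)%E.
Proof.
have term0 i y : (0 <= reachE i N rho y * (degE N y * energyE N y))%E.
  by rewrite mule_ge0// mule_ge0.
pose g y := (\sum_(i < n.+1) reachE i N rho y * (degE N y * energyE N y))%E.
have -> : (\sum_(i < n.+1) reached_energy i N rho = \sum_(y <oo) g y)%E.
  by rewrite [RHS]nneseries_sum.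
have g0 y : (0 <= g y)%E by exact: sume_ge0.
apply: le_trans (sum_fset_le_nneseries V g0).
rewrite /energy_mass -sumEFin; apply: lee_sum => x _.
have [s sn pow_neq0] := V_reached x.
have sn1 : (s < n.+1)%N by rewrite ltnS.
rewrite /g (bigD1 (Ordinal sn1))//= {1}/reachE pow_neq0 mul1e.
apply: (@le_trans _ _ (degE N (val x) * energyE N (val x))%E); last first.
  by rewrite leeDl// sume_ge0.
rewrite EFinM -(degE_wf wfN (V_comp x)) lee_wpmul2l//; exact: energy_le_energyE.
Qed.

Lemma walkE_max_sqr_wdist_le (L H M : R) : 0 < cdeg N rho -> 0 < L ->
  (\sum_(i < n.+1) mean_energy i N rho <= H%:E)%E ->
  (\sum_(i < n.+1) reached_energy i N rho <= M%:E)%E ->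
  walkE N n rho (fun s => \big[Num.max/0]_(x <- s) wdist N rho x ^+ 2) <=
  1 + 3 * L * H + n%:R ^+ 4 * (16 * expR (1 - L / 32)) * (H + M / cdeg N rho).
Proof.
move=> co L0 HH MM.
have -> : walkE N n rho (fun s => \big[Num.max/0]_(x <- s) wdist N rho x ^+ 2) =
    pathE p n o (fun s => \big[Num.max/0]_(x <- s) f x ^+ 2).
  rewrite -[in LHS]/(val o) (@walkE_pathE n 0 o)//; last by rewrite powE0_refl onee_neq0.
  by apply: eq_pathE => // t _; rewrite big_map.
have fo : f o = 0 by exact: (wdist_root wfN).
have f_ge0 x : 0 <= f x by exact: (wdist_ge0 wfN).
have c_ge0 x : 0 <= c x by exact: (cdeg_ge0 wfN).
apply: (le_trans (max_sqr_displacement_le (o := o) n p_ge0 p_le1 c_ge0 p_rev co f_ge0 fo L0)).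
have total_le : total_energy p f o n <= H.
  by rewrite -lee_fin (le_trans total_energy_le_mean_energy).
have mass_le : energy_mass p c f <= M.
  by rewrite -lee_fin (le_trans energy_mass_le_reached_energy).
apply: lerD; first by rewrite lerD2l ler_wpM2l// mulr_ge0// ltW.
apply: ler_wpM2l; first by rewrite !mulr_ge0 ?exprn_ge0 ?expR_ge0.
by rewrite lerD// ler_pM2r ?invr_gt0.
Qed.

End ReachedSet.

(** * Growth rates *)

Section RiemannSeries.
Context (R : realType).
Implicit Types (a e x : R).

Lemma powRN_telescope e x : 0 < e -> 0 < x ->
  e * (x + 1) `^ (- (1 + e)) <= x `^ (- e) - (x + 1) `^ (- e).
Proof.
move=> e0 x0; have y0 : 0 < x + 1 by lra.
have ln_ratio : ln x - ln (x + 1) <= - (x + 1)^-1.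
  rewrite -ln_div ?posrE// (_ : - (x + 1)^-1 = x / (x + 1) - 1); last by field; lra.
  rewrite -{1}[x / (x + 1)](addrNK 1) addrC le_ln1Dx//.
  by rewrite ltrBrDl subrr divr_gt0.
have -> : x `^ (- e) = (x + 1) `^ (- e) * expR (e * (ln (x + 1) - ln x)).
  by rewrite /powR !gt_eqF// -expRD; congr expR; ring.
have -> : (x + 1) `^ (- (1 + e)) = (x + 1) `^ (- e) / (x + 1).
  rewrite opprD [- 1 - e]addrC powRD ?powR_inv1 ?(ltW y0)//.
  by rewrite (gt_eqF y0) implybT.
rewrite mulrCA -[X in _ - X]mulr1 -mulrBr ler_wpM2l ?powR_ge0// lerBrDl.
apply: le_trans (expR_ge1Dx _); rewrite lerD2l ler_wpM2l ?(ltW e0)//; lra.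
Qed.

Lemma riemannR_summable a : 1 < a -> (\sum_(n <oo) (riemannR a n)%:E < +oo)%E.
Proof.
move=> a1; have [e e0 ->] : exists2 e, 0 < e & a = 1 + e by exists (a - 1); lra.
have partial n : e * \sum_(i < n) i.+2%:R `^ (- (1 + e)) <= 1 - n.+1%:R `^ (- e).
  elim: n => [|n IH]; first by rewrite big_ord0 powR1 mulr0 subrr.
  rewrite big_ord_recr/= mulrDr; have := powRN_telescope e0 (ltr0Sn R n).
  by rewrite natr1; lra.
apply: (@le_lt_trans _ _ (1 + e^-1)%:E); last exact: ltry.
apply: lime_le; first by apply: is_cvg_nneseries => n _ _; rewrite lee_fin invr_ge0 powR_ge0.
apply: nearW => -[|n]; first by rewrite big_geq// lee_fin addr_ge0// invr_ge0 ltW.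
rewrite big_mkord sumEFin lee_fin big_ord_recl /riemannR/= powR1 invr1 lerD2l.
under eq_bigr do rewrite -powRN.
rewrite -[leRHS]mul1r ler_pdivlMr// mulrC; apply: le_trans (partial n) _.
by rewrite lerBlDr lerDl powR_ge0.
Qed.

End RiemannSeries.

Lemma ae_partial_sums_le (R : realType) (d : measure_display) (T : measurableType d)
    (mu : {measure set T -> \bar R}) (g : nat -> T -> \bar R) (E : \bar R) (a : R) :
  (forall i w, 0 <= g i w)%E -> (forall i, measurable_fun setT (g i)) ->
  (forall i, \int[mu]_w g i w <= E)%E -> (E < +oo)%E -> 1 < a ->
  {ae mu, forall w, exists2 A : R, 0 <= A & forall n, (0 < n)%N ->
    (\sum_(i < n.+1) g i w <= (A * n%:R `^ a)%:E)%E}.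
Proof.
move=> g0 mg gE Efin a1.
pose r i : R := riemannR a i; pose G w := (\sum_(i <oo) (r i)%:E * g i w)%E.
have r0 i : 0 <= r i by rewrite invr_ge0 powR_ge0.
have term0 i w : (0 <= (r i)%:E * g i w)%E by rewrite mule_ge0// lee_fin.
have mterm i : measurable_fun setT (fun w => (r i)%:E * g i w)%E.
  by apply: emeasurable_funM => //; exact: mg.
have E0 : (0 <= E)%E by apply: le_trans (gE 0%N); exact: integral_ge0.
have iG : mu.-integrable setT G.
  apply/integrableP; split; first exact: ge0_emeasurable_sum.
  under eq_integral do rewrite gee0_abs ?nneseries_ge0//.
  rewrite integral_nneseries//.
  apply: (@le_lt_trans _ _ (\sum_(i <oo) (E * (r i)%:E))%E).
    apply: lee_nneseries => [i _ _|i _]; first exact: integral_ge0.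
    by rewrite ge0_integralZl ?lee_fin// muleC lee_wpmul2r ?lee_fin.
  rewrite nneseriesMl//; apply: lte_mul_pinfty; rewrite ?ge0_fin_numE//.
  exact: riemannR_summable.
apply: filterS (integrable_ae measurableT iG) => w /(_ I) Gfin.
exists (2 `^ a * fine (G w)) => [|n n0].
  by rewrite mulr_ge0 ?powR_ge0// fine_ge0// nneseries_ge0.
rewrite mulrAC EFinM fineK// -powRM// -natrM mul2n -addnn.
apply: (@le_trans _ _ (((n + n)%:R `^ a)%:E * \sum_(i < n.+1) (r i)%:E * g i w)%E).
  rewrite ge0_sume_distrr//; apply: lee_sum => i _.
  rewrite muleA -EFinM -[leLHS]mul1e lee_wpmul2r// lee_fin ler_pdivlMr ?powR_gt0// mul1r.
  apply: ge0_ler_powR; rewrite ?nnegrE//; first lra.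
  by rewrite ler_nat (leq_trans (ltn_ord i))// -addn1 leq_add2l.
rewrite lee_wpmul2l ?lee_fin ?powR_ge0//.
rewrite -(big_mkord predT (fun i => (r i)%:E * g i w)%E).
exact: nneseries_lim_ge.
Qed.

Section DisplacementGrowth.
Context (R : realType).
Implicit Types (A B C e t x : R).

Lemma ln_le_powR_div e x : 0 < e -> 0 < x -> ln x <= x `^ e / e.
Proof.
move=> e0 x0; rewrite ler_pdivlMr// mulrC -ln_powR; apply/ltW/ln_sublinear.
by rewrite powR_gt0.
Qed.

Lemma exists_powR_ge C e : 0 < e -> exists k : nat, forall n, (k <= n)%N -> C <= n%:R `^ e.
Proof.
move=> e0; have [C0|C0] := leP C 0; first by exists 0%N => n _; rewrite (le_trans C0)// powR_ge0.
exists (Num.bound (C `^ e^-1)) => n kn.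
have -> : C = (C `^ e^-1) `^ e by rewrite -powRrM mulVf ?powRr1 ?gt_eqF// ltW.
apply: ge0_ler_powR; rewrite ?nnegrE ?powR_ge0 ?(ltW e0)//.
by rewrite (le_trans (ltW (archi_boundP (powR_ge0 _ _))))// ler_nat.
Qed.

Lemma error_term_le A B e t x : 0 <= A -> 0 <= B -> e <= 1 -> 0 <= t -> 1 <= x ->
  x ^+ 4 * (16 * expR (- t - 8 * ln x)) *
    (A * x `^ (1 + e) + expR t * (B * x `^ (1 + e))) <= 16 * (A + B).
Proof.
move=> A0 B0 e1 t0 x1; have x0 : 0 < x by lra.
have -> : expR (- t - 8 * ln x) = expR (- t) / x ^+ 8.
  by rewrite expRD [expR (- (8 * _))]expRN [8 * _]mulr_natl -lnXn// lnK// posrE exprn_gt0.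
have powx_le : x `^ (1 + e) <= x ^+ 4.
  by rewrite -powR_mulrn ?(ltW x0)//; apply: ler_powR => //; lra.
have -> : x ^+ 4 * (16 * (expR (- t) / x ^+ 8)) *
    (A * x `^ (1 + e) + expR t * (B * x `^ (1 + e))) =
  16 * (x `^ (1 + e) / x ^+ 4 * (expR (- t) * A + expR (- t) * expR t * B)).
  by field; rewrite gt_eqF.
rewrite -expRD addNr expR0 mul1r ler_wpM2l//.
have eA0 : 0 <= expR (- t) * A by rewrite mulr_ge0 ?expR_ge0.
apply: (@le_trans _ _ (expR (- t) * A + B)).
  by rewrite ler_piMl ?addr_ge0// ler_pdivrMr ?exprn_gt0// mul1r.
by rewrite lerD2r ler_piMl// -expR0 ler_expR; lra.
Qed.

(* With this [L] the factor [expR (1 - L / 32)] cancels both [expR t] and [x ^+ 8]. *)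
Lemma displacement_bound_le A B e t x L : 0 <= A -> 0 <= B -> 0 < e -> e <= 1 ->
  0 <= t <= 2 * x `^ e -> 1 <= x -> L = 32 * (1 + t + 8 * ln x) ->
  1 + 3 * L * (A * x `^ (1 + e)) + x ^+ 4 * (16 * expR (1 - L / 32)) *
    (A * x `^ (1 + e) + expR t * (B * x `^ (1 + e))) <=
  (1 + 16 * (A + B) + 96 * A * (3 + 8 / e)) * x `^ (1 + 2 * e).
Proof.
move=> A0 B0 e0 e1 /andP[t0 t_le] x1 LE; have x0 : 0 < x by lra.
have -> : 1 - L / 32 = - t - 8 * ln x by rewrite LE; field.
apply: (le_trans (lerD (lexx _) (error_term_le A0 B0 e1 t0 x1))).
have xe1 : 1 <= x `^ e by rewrite -[leLHS](powRr0 x) ler_powR// ltW.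
have x2e1 : 1 <= x `^ (1 + 2 * e) by rewrite -[leLHS](powRr0 x) ler_powR//; lra.
have lnx := ln_le_powR_div e0 x0.
have main : 3 * L * (A * x `^ (1 + e)) <= 96 * A * (3 + 8 / e) * x `^ (1 + 2 * e).
  have -> : x `^ (1 + 2 * e) = x `^ (1 + e) * x `^ e.
    rewrite -powRD; first by congr (_ `^ _); lra.
    by rewrite (gt_eqF x0) implybT.
  have -> : 3 * L * (A * x `^ (1 + e)) =
    96 * (A * x `^ (1 + e)) * (1 + t + 8 * ln x) by rewrite LE; ring.
  have -> : 96 * A * (3 + 8 / e) * (x `^ (1 + e) * x `^ e) =
    96 * (A * x `^ (1 + e)) * (x `^ e + 2 * x `^ e + 8 * (x `^ e / e)) by ring.
  by rewrite ler_wpM2l ?mulr_ge0 ?powR_ge0//; lra.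
apply: (le_trans (lerD (lerD (lexx 1) main) (lexx _))).
rewrite addrAC [leRHS]mulrDl lerD2r ler_peMr//; lra.
Qed.

End DisplacementGrowth.

Lemma quenched_displacement_growth (R : realType) (N : network R) (rho : nat)
    (A B e delta : R) :
  wf_network N rho -> 0 < cdeg N rho -> 0 <= A -> 0 <= B ->
  0 < e -> e <= 1 -> 4 * e <= delta ->
  (forall n, (0 < n)%N ->
    (\sum_(i < n.+1) mean_energy i N rho <= (A * n%:R `^ (1 + e))%:E)%E) ->
  (forall n, (0 < n)%N ->
    (\sum_(i < n.+1) mean_share i N rho <= (B * n%:R `^ (1 + e))%:E)%E) ->
  (fun r : nat => ln (ln (vol N rho r)) / ln r%:R) @ \oo --> (0 : R) ->
  exists n0 : nat, forall n : nat, (n0 <= n)%N ->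
     walkE N n rho (fun s => \big[Num.max/0]_(x <- s) wdist N rho x ^+ 2)
     <= n%:R `^ (1 + delta).
Proof.
move=> wfN c0 A0 B0 e0 e1 ed sumA sumB vlim.
have [r0 vol_le] := vol_subexponential e0 vlim.
have Bc0 : 0 <= B / cdeg N rho by rewrite divr_ge0// ltW.
pose C := 1 + 16 * (A + B / cdeg N rho) + 96 * A * (3 + 8 / e).
have [k C_le] : exists k : nat, forall n, (k <= n)%N -> C <= n%:R `^ (2 * e).
  by apply: exists_powR_ge; rewrite mulr_gt0.
exists (maxn r0 (maxn k 1)) => n; rewrite !geq_max => /and3P[r0n kn n0].
have x1 : 1 <= n%:R :> R by rewrite ler1n.
pose t : R := (n + n)%:R `^ e.
have t_le : t <= 2 * n%:R `^ e.
  rewrite /t addnn -mul2n natrM powRM// ler_wpM2r ?powR_ge0//.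
  by apply: ler1_powR => //; rewrite ler1n.
have t_ge0 : 0 <= t by exact: powR_ge0.
pose L : R := 32 * (1 + t + 8 * ln n%:R).
have L0 : 0 < L.
  by rewrite mulr_gt0// -addrA ltr_pwDl// addr_ge0// mulr_ge0// ln_ge0.
have reached_le : (\sum_(i < n.+1) reached_energy i N rho <=
    (vol N rho (n + n) * (B * n%:R `^ (1 + e)))%:E)%E.
  apply: (le_trans (sum_reached_energy_le wfN n c0)).
  by rewrite EFinM lee_wpmul2l ?lee_fin ?vol_ge0// sumB.
apply: (le_trans (walkE_max_sqr_wdist_le wfN c0 L0 (sumA n n0) reached_le)).
apply: (@le_trans _ _ (C * n%:R `^ (1 + 2 * e))); last first.
  apply: (@le_trans _ _ (n%:R `^ (2 * e) * n%:R `^ (1 + 2 * e))).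
    by rewrite ler_wpM2r ?powR_ge0 ?C_le.
  rewrite -powRD; last by rewrite pnatr_eq0 -lt0n n0 implybT.
  by apply: ler_powR => //; lra.
have t_bounds : 0 <= t <= 2 * n%:R `^ e by rewrite t_ge0.
apply: le_trans (displacement_bound_le A0 Bc0 e0 e1 t_bounds x1 (erefl L)).
rewrite lerD2l ler_wpM2l ?mulr_ge0 ?exprn_ge0 ?expR_ge0// lerD2l -mulrA [_ / _]mulrAC.
rewrite ler_wpM2r ?vol_le ?(leq_trans r0n) ?leq_addr//.
by rewrite mulr_ge0 ?powR_ge0.
Qed.

Theorem theorem1p5 (R : realType) (d : measure_display) (Omega : measurableType d)
  (P : probability Omega R) (net : Omega -> network R) (rt : Omega -> nat) :
  random_network net rt ->
  reversible P net rt ->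
  (\int[P]_w ((cdeg (net w) (rt w))^-1)%:E < +oo)%E ->
  {ae P, forall w,
     (fun r : nat => ln (ln (vol (net w) (rt w) r)) / ln r%:R) @ \oo --> (0 : R)} ->
  (\int[P]_w (\sum_(y \in nbrs (net w) (rt w))
                 step (net w) (rt w) y * wt (net w) (rt w) y ^+ 2)%:E < +oo)%E ->
  forall delta : R, 0 < delta ->
  {ae P, forall w, exists n0 : nat, forall n : nat, (n0 <= n)%N ->
     walkE (net w) n (rt w)
       (fun s => \big[Num.max/0]_(x <- s) wdist (net w) (rt w) x ^+ 2)
     <= n%:R `^ (1 + delta)}.
Proof.
move=> rnet rev _ vlim; rewrite -(integral_energyE P rnet) => energy_fin delta delta0.
have [e [e0 e1 ed]] : exists e : R, [/\ 0 < e, e <= 1 & 4 * e <= delta].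
  exists (Num.min (delta / 4) 1); rewrite lt_min divr_gt0//= ge_min lexx orbT.
  by split; rewrite // mulrC -ler_pdivlMr// ge_min lexx.
have a1 : 1 < 1 + e by rewrite ltrDl.
have energy_growth := ae_partial_sums_le
  (fun i w => mean_energy_ge0 i (net w) (rt w))
  (fun i => measurable_transport_root rnet (transport_mean_energy R i))
  (integral_mean_energy_le rnet rev) energy_fin a1.
have share_growth := ae_partial_sums_le
  (fun i w => mean_share_ge0 i (net w) (rt w))
  (fun i => measurable_transport_root rnet (transport_mean_share R i))
  (integral_mean_share_le rnet rev) energy_fin a1.
have wf w : wf_network (net w) (rt w) by exact: random_network_wf.
have [deg_gt0 _] := rev.
apply: filterS3 energy_growth share_growth (filterI deg_gt0 vlim).
move=> w [A A0 energy_le] [B B0 share_le] [c0 vol_subexp].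
exact: (quenched_displacement_growth (wf w) c0 A0 B0 e0 e1 ed energy_le share_le vol_subexp).
Qed.
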